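(* Let $(\mathcal{X}=\{X_0,\ldots,X_m\},\mathfrak{C})$ and $(\mathcal{Y}=\{Y_0,\ldots,Y_m\},\mathfrak{C})$ be two real analytic control-affine systems on $\mathbb{R}^n$, both satisfying the Assumption stated in the context (so in particular $\mathfrak{C}=[-1,1]^m$), let $x_0\in\mathbb{R}^n$ and let $N\ge 1$ be an integer. Suppose that: (i) $x_0$ is an equilibrium point of both $\mathcal{X}$ and $\mathcal{Y}$, i.e. $X_0(x_0)=0$ and $Y_0(x_0)=0$; (ii) $\mathcal{X}$ satisfies the growth rate condition of order $N$ at $x_0$; (iii) for every $i\in\{0,\ldots,m\}$, the vector fields $X_i$ and $Y_i$ have the same Taylor polynomial of order $N$ around $x_0$. Then $\mathcal{Y}$ satisfies the growth rate condition of order $N$ at $x_0$.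
   Context: A real analytic control-affine system on $\mathbb{R}^n$ is a pair $(\mathcal{X},\mathfrak{C})$, where $\mathcal{X}=\{X_0,X_1,\ldots,X_m\}$ is an ordered family of real analytic vector fields on $\mathbb{R}^n$ and $\mathfrak{C}\subseteq\mathbb{R}^m$ is a set with $0\in\mathfrak{C}$. A trajectory is an absolutely continuous curve $x:[0,T]\to\mathbb{R}^n$ such that $\dot x(t)=X_0(x(t))+\sum_{i=1}^m u_i(t)X_i(x(t))$ for almost every $t\in[0,T]$, for some measurable control $u=(u_1,\ldots,u_m):[0,T]\to\mathfrak{C}$. The reachable set from $x_0$ in time at most $t$ is $$\mathrm{R}_{\mathcal{X}}(\le t,x_0)=\{x(T)\mid x:[0,T]\to\mathbb{R}^n\text{ is a trajectory of }\mathcal{X},\ x(0)=x_0,\ 0\le T\le t\}.$$ $\overline{\mathrm{B}}(x_0,r)$ is the closed Euclidean ball of radius $r$ centred at $x_0$. Growth rate condition of order $N$ at an equilibrium point $x_0$: there exist $C,T>0$ such that for every $t\in(0,T]$, $\overline{\mathrm{B}}(x_0,Ct^N)\subset\mathrm{R}_{\mathcal{X}}(\le t,x_0)$. For $\mathbf{u}=(u_1,\ldots,u_m)\in\mathfrak{C}$ write $X_{\mathbf{u}}=X_0+\sum_{i=1}^m u_iX_i$. For $p\ge1$, $\mathbf{I}=(\mathbf{u}^1,\ldots,\mathbf{u}^p)\in\mathfrak{C}^p$ and $\mathbf{t}=(t_1,\ldots,t_p)\in\mathbb{R}_{>0}^p$, let $X^{\mathbf{I},\mathbf{t}}$ be the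 time-dependent vector field on the time interval $[0,t_1+\cdots+t_p]$ equal to $X_{\mathbf{u}^p}$ on $[0,t_p]$, to $X_{\mathbf{u}^{p-1}}$ on $(t_p,t_{p-1}+t_p]$, ..., and to $X_{\mathbf{u}^1}$ on $(t_2+\cdots+t_p,t_1+\cdots+t_p]$. Assumption on $(\mathcal{X},\mathfrak{C})$: (i) for all $p\ge 1$, $\mathbf{I}\in\mathfrak{C}^p$ and $\mathbf{t}\in\mathbb{R}_{>0}^p$, the vector field $X^{\mathbf{I},\mathbf{t}}$ is complete, i.e. for every initial point its integral curve exists for all times at which the vector field is defined; (ii) $\mathfrak{C}=[-1,1]^m$. Two vector fields have the same Taylor polynomial of order $N$ around $x_0$ if all their partial derivatives of order $\le N$ (including order $0$) agree at $x_0$. *)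

(* Defs.v *)
From HB Require Import structures.
From mathcomp Require Import all_boot all_order all_algebra.
From mathcomp Require Import all_classical all_reals all_analysis.
Set Implicit Arguments.
Unset Strict Implicit.
Unset Printing Implicit Defensive.
Import Order.TTheory GRing.Theory Num.Theory.
Import numFieldNormedType.Exports.
Local Open Scope classical_set_scope.
Local Open Scope ring_scope.

Section Definitions.
Context {R : realType}.

(* The norm of 'rV[R]_n provided by the library is the sup norm. *)
Definition euclidean_norm (n : nat) (v : 'rV[R]_n) : R :=
  Num.sqrt (\sum_i v ord0 i ^+ 2).

Definition euclidean_closed_ball (n : nat) (a : 'rV[R]_n) (r : R) :
    set 'rV[R]_n :=
  [set x | euclidean_norm (x - a) <= r].

Definition power_term (n : nat) (c : {ffun 'I_n -> nat} -> R)
    (a x : 'rV[R]_n) (al : {ffun 'I_n -> nat}) : R :=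
  c al * \prod_i (x ord0 i - a ord0 i) ^+ al i.

(* Absolute convergence makes the order of summation irrelevant; the value of
   the sum is computed along the multi-indices with all entries < k. *)
Definition analytic_at (n : nat) (f : 'rV[R]_n -> R) (a : 'rV[R]_n) : Prop :=
  exists c : {ffun 'I_n -> nat} -> R,
    \forall x \near a,
      summable [set: {ffun 'I_n -> nat}]
        (fun al => (power_term c a x al)%:E) /\
      (fun k : nat => \sum_(be : {ffun 'I_n -> 'I_k})
         power_term c a x [ffun i => nat_of_ord (be i)]) @ \oo --> f x.

Definition analytic_vector_field (n : nat) (F : 'rV[R]_n -> 'rV[R]_n) : Prop :=
  forall (j : 'I_n) (a : 'rV[R]_n), analytic_at (fun x => F x ord0 j) a.

Definition partial (n : nat) (i : 'I_n) (f : 'rV[R]_n -> R) : 'rV[R]_n -> R :=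
  fun x => 'D_(delta_mx ord0 i) f x.

Definition iter_partial (n : nat) (s : seq 'I_n) (f : 'rV[R]_n -> R) :
    'rV[R]_n -> R :=
  foldr (@partial n) f s.

Definition same_taylor (n N : nat) (x0 : 'rV[R]_n)
    (F G : 'rV[R]_n -> 'rV[R]_n) : Prop :=
  forall (j : 'I_n) (s : seq 'I_n), (size s <= N)%N ->
    iter_partial s (fun x => F x ord0 j) x0 =
    iter_partial s (fun x => G x ord0 j) x0.

Definition absolutely_continuous_on (n : nat) (T : R) (x : R -> 'rV[R]_n) :
    Prop :=
  forall e : R, 0 < e -> exists2 d : R, 0 < d &
    forall (k : nat) (a b : 'I_k -> R),
      (forall i, [/\ 0 <= a i, a i <= b i & b i <= T]) ->
      (forall i j, i != j -> b i <= a j \/ b j <= a i) ->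
      \sum_i (b i - a i) < d ->
      \sum_i euclidean_norm (x (b i) - x (a i)) < e.

(* A curve [0, T] -> R^n is a total function of which only the restriction to
   [0, T] matters: the two end points form a null set. *)
Definition integral_curve (n : nat) (V : R -> 'rV[R]_n -> 'rV[R]_n) (T : R)
    (x : R -> 'rV[R]_n) : Prop :=
  absolutely_continuous_on T x /\
  {ae lebesgue_measure, forall t : R, 0 <= t <= T ->
     is_derive t (1 : R) x (V t (x t))}.

Definition complete_on (n : nat) (V : R -> 'rV[R]_n -> 'rV[R]_n) (T : R) :
    Prop :=
  forall x0 : 'rV[R]_n, exists2 x : R -> 'rV[R]_n,
    x 0 = x0 & integral_curve V T x.

Section Systems.
Variables (n m : nat).
Variables (X : 'I_m.+1 -> 'rV[R]_n -> 'rV[R]_n) (U : set 'rV[R]_m).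

Definition analytic_control_affine_system : Prop :=
  (forall i, analytic_vector_field (X i)) /\ U 0.

Definition controlled_field (u : 'rV[R]_m) (x : 'rV[R]_n) : 'rV[R]_n :=
  X ord0 x + \sum_(i < m) u ord0 i *: X (lift ord0 i) x.

Definition trajectory (T : R) (x : R -> 'rV[R]_n) : Prop :=
  exists u : R -> 'rV[R]_m,
    [/\ forall i, measurable_fun `[0, T] (fun t => u t ord0 i),
        forall t, 0 <= t <= T -> U (u t) &
        integral_curve (fun t => controlled_field (u t)) T x].

Definition reachable (t : R) (x0 : 'rV[R]_n) : set 'rV[R]_n :=
  [set y | exists (T : R) (x : R -> 'rV[R]_n),
     [/\ 0 <= T <= t, trajectory T x, x 0 = x0 & x T = y]].

Definition equilibrium (x0 : 'rV[R]_n) : Prop := X ord0 x0 = 0.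

Definition growth_rate_condition (N : nat) (x0 : 'rV[R]_n) : Prop :=
  exists C T : R, [/\ 0 < C, 0 < T &
    forall t : R, 0 < t <= T ->
      euclidean_closed_ball x0 (C * t ^+ N) `<=` reachable t x0].

(* With p.+1 controls I 0, ..., I p and durations tt 0, ..., tt p, the last
   control acts first: I j is used on the half-open interval
   ]tt (j+1) + ... + tt p, tt j + ... + tt p], and I p also at time 0, where
   the [pick] fails. *)
Definition switching_control (p : nat) (I : 'I_p.+1 -> 'rV[R]_m)
    (tt : 'I_p.+1 -> R) (s : R) : 'rV[R]_m :=
  I (odflt ord_max
       [pick j : 'I_p.+1 | \sum_(k < p.+1 | (j < k)%N) tt k < s
                             <= \sum_(k < p.+1 | (j <= k)%N) tt k]).

Definition switched_field (p : nat) (I : 'I_p.+1 -> 'rV[R]_m)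
    (tt : 'I_p.+1 -> R) (s : R) : 'rV[R]_n -> 'rV[R]_n :=
  controlled_field (switching_control I tt s).

Definition switched_complete : Prop :=
  forall (p : nat) (I : 'I_p.+1 -> 'rV[R]_m) (tt : 'I_p.+1 -> R),
    (forall j, U (I j)) -> (forall j, 0 < tt j) ->
    complete_on (switched_field I tt) (\sum_j tt j).

Definition standing_assumption : Prop :=
  switched_complete /\ U = [set u | forall i, -1 <= u ord0 i <= 1].

End Systems.
End Definitions.

(* Main.v *)
From HB Require Import structures.
Require Import Defs.
From mathcomp Require Import all_boot all_order all_algebra.
From mathcomp Require Import all_classical all_reals all_analysis.
From mathcomp Require Import measurable_realfun ring lra zify.
Set Implicit Arguments.
Unset Strict Implicit.
Unset Printing Implicit Defensive.
Import Order.TTheory GRing.Theory Num.Theory.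
Import numFieldNormedType.Exports.
Local Open Scope classical_set_scope.
Local Open Scope ring_scope.

(** Let [|y - x0| <= C (tau / 2) ^ N]. The system [X] reaches [y] from [x0] in
    time at most [tau / 2]; running [Y] backward from [y] with the same control
    ends at a point [y1]. Both systems agree to order [N] at [x0] and move at
    bounded speed, so by Gronwall [|y1 - x0| = O(tau ^ (N + 1))], which for
    small [tau] is at most [C (tau / 4) ^ N]. Hence [y1] is itself reached by
    [X] from [x0] in time at most [tau / 4], and the argument repeats. The
    controls obtained on the intervals [tau / 2 ^ (k + 1), tau / 2 ^ k] together
    form one measurable control on [0, tau], whose [Y]-trajectory through [y] at
    time [tau] tends to [x0] at time [0]. No fixed point theorem is needed,
    because the correction of the end point is made at the beginning of the
    trajectory, near the equilibrium. *)

(** Every stage solves a terminal value problem with [z tau = y]. Changing the control before a time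
    therefore leaves the solution after that time untouched, and later stages never spoil what
    earlier ones achieved. A stage gains a power of time because the trajectory of [X] starts at
    [x0]: in a window of length [s] it stays within [M * s] of [x0], the fields differ there by at
    most [M * (M * s) ^ N], and integrating over the window contributes one more factor [s]. Halving
    the window divides the reachable radius only by the constant [2 ^ N], so smallness of [tau]
    closes the recursion. The trajectory of [X] may take less than the available time; the rest is
    spent with control 0, under which [x0] is at rest for [Y]. *)

Lemma real_induction (R : realType) (P : R -> Prop) (a b : R) : a <= b -> P a ->
  (forall t, a <= t < b -> P t ->
     exists2 t', t < t' & forall s, t < s <= t' -> P s) ->
  (forall s, a < s <= b -> (forall t, a <= t < s -> P t) -> P s) ->
  P b.
Proof.
move=> ab Pa Pr Pl.
(* The supremum [c] of [S] must be [b]: the last hypothesis gives [P c], and if [c < b] the step to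
   the right would put a point beyond [c] in [S]. *)
pose S := [set t | a <= t <= b /\ forall s, a <= s <= t -> P s].
have Sa : S a.
  split; first by rewrite lexx.
  by move=> s sa; have -> : s = a by apply/eqP; rewrite eq_le andbC.
have hS : has_sup S by split; [exists a|exists b => t [/andP[_ ->]]].
set c := sup S.
have ac : a <= c by apply: ub_le_sup => //; case: hS.
have cb : c <= b by apply: ge_sup; [exists a|move=> t [/andP[_ ->]]].
have Pc : forall t, a <= t < c -> P t.
  move=> t /andP[at_ tc]; have [u Su tu] := sup_adherent (eps := c - t)
    ltac:(by rewrite subr_gt0) hS.
  rewrite subKr in tu.
  by case: Su => _; apply; rewrite at_ ltW.
have Pcc : P c.
  have [->//|ac'] := eqVneq c a.
  by apply: Pl => //; rewrite lt_neqAle eq_sym ac' ac cb.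
have [<-//|cb'] := eqVneq c b.
have [t' ct' Pt'] := Pr c ltac:(by rewrite ac lt_neqAle cb' cb) Pcc.
have : S (Num.min t' b).
  split.
    by rewrite le_min (le_trans ac (ltW ct')) ab ge_min lexx orbT.
  move=> s; rewrite le_min => /and3P[as_ st' sb].
  have [sc|cs] := ltP s c; first by apply: Pc; rewrite as_.
  have [->//|sc] := eqVneq s c.
  by apply: Pt'; rewrite lt_neqAle eq_sym sc cs.
move/(ub_le_sup hS.2); rewrite -/c leNgt lt_min ct'.
by rewrite lt_neqAle cb' cb.
Qed.

(** * Comparison of the sup norm with the Euclidean norm *)

Section RowNorm.
Context {R : realType} {n : nat}.
Implicit Types v : 'rV[R]_n.

Lemma row_norm_le v (r : R) : 0 <= r -> (forall j, `|v ord0 j| <= r) -> `|v| <=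
  r.
Proof.
move=> r0 vr; rewrite /Num.norm/= mx_normrE; apply/bigmax_leP;
  split=> //= -[i j] _.
by rewrite (ord1 i).
Qed.

Lemma row_norm_coord v j : `|v ord0 j| <= `|v|.
Proof.
rewrite [leRHS]/Num.norm/= mx_normrE.
exact: (le_bigmax _ (fun ij : 'I_1 * 'I_n => `|v ij.1 ij.2|) (ord0, j)).
Qed.

Lemma le_norm_euclidean v : `|v| <= euclidean_norm v.
Proof.
apply: row_norm_le => [|j]; first exact: sqrtr_ge0.
rewrite -(sqrtr_sqr (v ord0 j)) ler_sqrt ?sqr_ge0//; last first.
  by apply: sumr_ge0 => i _; exact: sqr_ge0.
by rewrite (bigD1 j)//= lerDl sumr_ge0// => i _; exact: sqr_ge0.
Qed.

(** The crude factor [n.+1] is positive even for [n = 0], so the final choice of constants can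
    divide by it. *)
Lemma euclidean_le_norm v : euclidean_norm v <= n.+1%:R * `|v|.
Proof.
rewrite -[leRHS]ger0_norm ?mulr_ge0// -sqrtr_sqr ler_sqrt ?sqr_ge0// exprMn.
apply: le_trans (_ : \sum_(i < n) `|v| ^+ 2 <= _).
  apply: ler_sum => i _.
  by rewrite -[leLHS](real_normK (num_real _)) lerXn2r// ?nnegrE//
    row_norm_coord.
rewrite sumr_const card_ord -[leLHS]mulr_natl ler_wpM2r ?sqr_ge0//.
by rewrite -natrX ler_nat (leq_trans (leqnSn n))// leq_pmulr.
Qed.
End RowNorm.

(** * Derivatives and absolute continuity of curves on a window *)

Section DerivAt.
Context {R : realType} {V : normedModType R}.
Implicit Types (w : R -> V) (t : R) (d : V).

(** First-order expansion without a quotient: differences, shifts and coordinates follow from the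
    triangle inequality, and [h = 0] is no exception. *)
Definition deriv_at (w : R -> V) t (d : V) := forall e : R, 0 < e ->
  \forall h \near (0 : R), `|w (t + h) - w t - h *: d| <= e * `|h|.

Lemma deriv_at_is_derive w t d : deriv_at w t d -> is_derive t (1 : R) w d.
Proof.
move=> hd.
suff wd : h^-1 *: (w (h *: (1:R) + t) - w t) @[h --> 0^'] --> d.
  apply: DeriveDef; first by apply/cvg_ex; exists d.
  exact/cvg_lim.
apply/cvgrPdist_le => e e0; near=> h.
have h0 : h != 0 by near: h; exact: nbhs_dnbhs_neq.
rewrite -[d in X in X <= _](scalerK h0) -scalerBr normrZ normfV.
rewrite ler_pdivrMl ?normr_gt0// mulrC distrC.
have -> : h *: (1 : R) + t = t + h by rewrite addrC /GRing.scale/= mulr1.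
near: h; apply: nbhs_dnbhs; exact: hd.
Unshelve. all: by end_near. Qed.

Lemma is_derive_deriv_at w t d : is_derive t (1 : R) w d -> deriv_at w t d.
Proof.
move=> [/cvg_ex[l wl] dE] e e0.
have ld : l = d by rewrite -dE; apply/esym/cvg_lim.
rewrite {l}ld in wl.
move/cvgrPdist_le : wl => /(_ e e0).
rewrite near_withinE => H; near=> h.
have [->|h0] := eqVneq h 0.
  by rewrite addr0 subrr sub0r scale0r oppr0 !normr0 mulr0.
have : `|d - h^-1 *: (w (h *: (1:R) + t) - w t)| <= e by move: h0; near: h.
have -> : h *: (1 : R) + t = t + h by rewrite addrC /GRing.scale/= mulr1.
rewrite -(ler_pM2r (x := `|h|)) ?normr_gt0//; apply: le_trans.
rewrite [leRHS]mulrC -normrZ scalerBr scalerA divff// scale1r.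
by rewrite distrC.
Unshelve. all: by end_near. Qed.

End DerivAt.

Section Curves.
Context {R : realType} {n : nat}.
Implicit Types (w p q x : R -> 'rV[R]_n) (a b c t : R).

(* [absolutely_continuous_on] for a window [a, b], in the sup norm. *)
Definition ac_on a b w := forall e : R, 0 < e -> exists2 d : R, 0 < d &
  forall (k : nat) (l r : 'I_k -> R),
    (forall i, [/\ a <= l i, l i <= r i & r i <= b]) ->
    (forall i j, i != j -> r i <= l j \/ r j <= l i) ->
    \sum_i (r i - l i) < d -> \sum_i `|w (r i) - w (l i)| < e.

Lemma deriv_atB p q t d d' : deriv_at p t d -> deriv_at q t d' ->
  deriv_at (fun s => p s - q s) t (d - d').
Proof.
move=> hp hq e e0; have e2 : 0 < e / 2 by rewrite divr_gt0.
near=> h.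
have -> : p (t + h) - q (t + h) - (p t - q t) - h *: (d - d') =
  (p (t + h) - p t - h *: d) - (q (t + h) - q t - h *: d').
  by apply/rowP => i; rewrite !mxE; ring.
rewrite (splitr e) mulrDl (le_trans (ler_normB _ _))// lerD//; near: h;
  [exact: hp|exact: hq].
Unshelve. all: by end_near. Qed.

Lemma deriv_at_shift p t c d : deriv_at p (t - c) d ->
  deriv_at (fun s => p (s - c)) t d.
Proof.
by move=> hp e /hp; apply: filterS => h; rewrite (addrAC t h).
Qed.

Lemma deriv_at_cst (v : 'rV[R]_n) t : deriv_at (fun=> v) t 0.
Proof.
by move=> e e0; near=> h; rewrite subrr scaler0 subr0 normr0 mulr_ge0// ltW.
Unshelve. all: by end_near. Qed.

Lemma deriv_at_row w t (d : 'rV[R]_n) :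
  (forall j (e : R), 0 < e -> \forall h \near (0 : R),
     `|w (t + h) ord0 j - w t ord0 j - h * d ord0 j| <= e * `|h|) ->
  deriv_at w t d.
Proof.
move=> H e e0; near=> h; apply: row_norm_le => [|j];
  first by rewrite mulr_ge0// ltW.
rewrite !mxE; move: j; near: h; apply: filter_forall => j; exact: H.
Unshelve. all: by end_near. Qed.

Lemma ac_onB a b p q : ac_on a b p -> ac_on a b q ->
  ac_on a b (fun s => p s - q s).
Proof.
move=> hp hq e e0; have e2 : 0 < e / 2 by rewrite divr_gt0.
have [d d0 Hp] := hp _ e2; have [d' d'0 Hq] := hq _ e2.
exists (Num.min d d'); first by rewrite lt_min d0.
move=> k l r lr dis; rewrite lt_min => /andP[sd sd'].
rewrite (splitr e).
apply: le_lt_trans (ltrD (Hp _ _ _ lr dis sd) (Hq _ _ _ lr dis sd')).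
rewrite -big_split/=; apply: ler_sum => i _.
rewrite (_ : _ - _ - _ = (p (r i) - p (l i)) - (q (r i) - q (l i)))
  ?ler_normB//.
by apply/rowP => ?; rewrite !mxE; ring.
Qed.

Lemma lipschitz_ac_on a b (M : R) w :
  (forall s t, a <= s -> s <= t -> t <= b -> `|w t - w s| <= M * (t - s)) ->
  ac_on a b w.
Proof.
move=> wM e e0; exists (e / (`|M| + 1)); first by rewrite divr_gt0// ltr_wpDl.
move=> k l r lr _ H.
apply: le_lt_trans (_ : (`|M| + 1) * \sum_i (r i - l i) < e); last first.
  by rewrite mulrC -ltr_pdivlMr// ltr_wpDl.
rewrite mulr_sumr; apply: ler_sum => i _; have [al lri rb] := lr i.
apply: le_trans (wM _ _ al lri rb) _; rewrite ler_wpM2r ?subr_ge0//.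
by rewrite (le_trans (ler_norm M))// lerDl.
Qed.

Lemma ac_on_shift a b c p : ac_on a b p ->
  ac_on (a + c) (b + c) (fun s => p (s - c)).
Proof.
move=> hp e /hp[d d0 H]; exists d => // k l r lr dis sd.
apply: (H k (fun i => l i - c) (fun i => r i - c)).
- by move=> i; have [? ? ?] := lr i; split; rewrite ?lerD2r// ?lerBrDr ?lerBlDr.
- by move=> i j /dis[] H'; [left|right]; rewrite lerD2r.
- by apply: le_lt_trans sd; apply: ler_sum => i _; rewrite opprB addrA subrK.
Qed.

Lemma ac_onS a b a' b' p : a <= a' -> b' <= b -> ac_on a b p -> ac_on a' b' p.
Proof.
move=> aa bb hp e /hp[d d0 H]; exists d => // k l r lr; apply: H => i.
by have [? ? ?] := lr i; split=> //; [exact: le_trans aa _|exact: le_trans bb].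
Qed.

Lemma ac_on_continuous a b p : ac_on a b p -> forall e, 0 < e ->
  exists2 d, 0 < d & forall t t', a <= t -> t <= t' -> t' <= b -> t' - t < d ->
    `|p t' - p t| < e.
Proof.
move=> hp e /hp[d d0 H]; exists d => // t t' at_ tt' t'b td.
have := H 1%N (fun=> t) (fun=> t'); rewrite !big_ord1; apply=> //.
by move=> i j; rewrite !ord1.
Qed.

End Curves.

(** * Absolutely continuous curves and null sets *)

Section MeanValue.
Context {R : realType} {n : nat}.
Implicit Types (w p q x : R -> 'rV[R]_n) (a b c t : R).
Notation mu := (@lebesgue_measure R).

Lemma ae_imply (P Q : R -> Prop) : (forall t, P t -> Q t) ->
  {ae mu, forall t, P t} -> {ae mu, forall t, Q t}.
Proof.
move=> PQ; apply: filterS; first exact: (ae_filter_ringOfSetsType mu).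
exact: PQ.
Qed.

Lemma ae_and (P Q : R -> Prop) : {ae mu, forall t, P t} ->
  {ae mu, forall t, Q t} -> {ae mu, forall t, P t /\ Q t}.
Proof. by apply: filterI; exact: (ae_filter_ringOfSetsType mu). Qed.

(** List form of absolute continuity for the mean value argument, which builds its family of
    intervals by adding the rightmost one at the head; hence the decreasing order. *)
Lemma ac_on_seq a b w (e d : R) (l : seq (R * R)) :
  (forall (k : nat) (l r : 'I_k -> R),
    (forall i, [/\ a <= l i, l i <= r i & r i <= b]) ->
    (forall i j, i != j -> r i <= l j \/ r j <= l i) ->
    \sum_i (r i - l i) < d -> \sum_i `|w (r i) - w (l i)| < e) ->
  (forall u, u \in l -> [/\ a <= u.1, u.1 <= u.2 & u.2 <= b]) ->
  pairwise (fun u v : R * R => v.2 <= u.1) l ->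
  \sum_(u <- l) (u.2 - u.1) < d ->
  \sum_(u <- l) `|w u.2 - w u.1| < e.
Proof.
move=> H lab pl; rewrite !(big_nth (0, 0)) !big_mkord => ld.
apply: (H _ (fun i : 'I_(size l) => (nth (0, 0) l i).1)) => //.
- by move=> i; apply: lab; rewrite mem_nth.
- move=> i j ij; have /(pairwiseP (0, 0)) P := pl.
  have [ij'|ji|/val_inj ij'] := ltngtP i j.
  + by right; apply: P; rewrite ?inE.
  + by left; apply: P; rewrite ?inE.
  + by rewrite ij' eqxx in ij.
Qed.

Lemma null_set_open_cover (A : set R) (d : R) : measurable A -> mu A = 0%E ->
  0 < d -> exists V : set R, [/\ open V, A `<=` V & (mu V < d%:E)%E].
Proof.
move=> mA A0 d0.
have [V [oV AV Vd]] := lebesgue_regularity_outer mA (eq_ind_r (fun z => (z <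
  +oo)%E) (ltry 0) A0) d0.
exists V; split => //; apply: le_lt_trans Vd.
have mV : measurable V by exact: open_measurable.
rewrite -(setDUK AV); apply: le_trans (measureU2 _ _ _) _ => //.
  exact: measurableD.
by rewrite [X in (X + _)%E]A0 add0e setDUK.
Qed.

(* Away from a null set the increments are controlled by the derivative; the
   null set is covered by an open set so small that absolute continuity bounds
   the total increment over the intervals [l] collected inside it. *)
Lemma ac_on_mean_value a b w (g : R) : a <= b -> 0 <= g -> ac_on a b w ->
  {ae mu, forall t, a < t < b -> exists2 d, deriv_at w t d & `|d| <= g} ->
  `|w b - w a| <= g * (b - a).
Proof.
move=> ab g0 acw [A0 [mA0 A00 A0P]].
pose A := A0 `|` [set a; b].
have mab : measurable [set a; b] by exact: measurableU.
have mA : measurable A by exact: measurableU.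
have A_0 : mu A = 0%E.
  apply/eqP; rewrite eq_le measure_ge0 andbT.
  apply: le_trans (measureU2 _ _ _) _ => //.
  rewrite [X in (X + _)%E]A00 add0e; apply: le_trans (measureU2 _ _ _) _ => //.
  by rewrite [X in (X + _)%E]lebesgue_measure_set1 [X in (_ +
    X)%E]lebesgue_measure_set1 adde0.
have ba0 : 0 <= b - a by rewrite subr_ge0.
have ba1 : 0 < b - a + 1 by rewrite ltr_wpDl.
(* The slack in the slope costs [e * (b - a)] and the collected increments cost [e], together
   [e']. *)
apply/ler_addgt0Pr => e' e'0; pose e := e' / (b - a + 1).
have e0 : 0 < e by rewrite divr_gt0.
have [d d0 wd] := acw e e0.
have [V [oV AV Vd]] := null_set_open_cover mA A_0 d0.
have mV : measurable V by exact: open_measurable.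
(* Invariant at time [t]. Comparing the total length with the part of [V] in []a, t]], and not with
   all of [V], is what allows an interval to be added on the right. *)
pose P t := exists l : seq (R * R),
  [/\ forall u, u \in l -> [/\ a <= u.1, u.1 <= u.2 & u.2 <= t],
      pairwise (fun u v : R * R => v.2 <= u.1) l,
      ((\sum_(u <- l) (u.2 - u.1))%:E <= mu (V `&` `]a, t]))%E &
      `|w t - w a| <= (g + e) * (t - a) + \sum_(u <- l) `|w u.2 - w u.1|].
have Pstep t t' : a <= t -> t <= t' ->
    (forall s, t <= s <= t' -> V s) \/ `|w t' - w t| <= (g + e) * (t' - t) ->
    P t -> P t'.
  move=> at_ tt' H [l [l1 l2 l3 l4]].
  have l1' u : u \in l -> [/\ a <= u.1, u.1 <= u.2 & u.2 <= t'].
    by move=> /l1[? ? ?]; split=> //; exact: le_trans tt'.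
  have wtri : `|w t' - w a| <= `|w t' - w t| + `|w t - w a|.
    by rewrite (le_trans _ (ler_normD _ _))// addrA subrK.
  have mut s : measurable (V `&` `]a, s]) by exact: measurableI.
  case: H => H.
    exists ((t, t') :: l); split.
    - by move=> u; rewrite inE => /predU1P[->|/l1'].
    - rewrite pairwise_cons l2 andbT; apply/allP => u /l1[_ _]; exact.
    - rewrite big_cons /= EFinD.
      have : (mu (V `&` `]a, t]) + mu `]t, t'] <= mu (V `&` `]a, t']))%E.
        have <- : mu ((V `&` `]a, t]) `|` `]t, t']) =
            (mu (V `&` `]a, t]) + mu `]t, t'])%E.
          apply: measureU; [exact: mut|exact: measurable_itv|].
          rewrite -subset0 => s /= [[_]].
          by rewrite !in_itv/= => /andP[_ st]; rewrite ltNge st.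
        apply: le_measure; rewrite ?inE; [|exact: mut|].
          by apply: measurableU; [exact: mut|exact: measurable_itv].
        move=> s [[Vs]|] /=; rewrite !in_itv/= => /andP[as_ st]; split => //=.
        - by rewrite as_ (le_trans st).
        - by apply: H; rewrite st ltW.
        - by rewrite st (le_lt_trans at_).
      apply: le_trans; rewrite addeC lebesgue_measure_itv/= lte_fin.
      apply: leeD => //; case: ltP => // t't.
      by rewrite lee_fin subr_le0.
    - rewrite big_cons/= addrCA (le_trans wtri)// lerD2l (le_trans l4)// lerD2r.
      by rewrite ler_wpM2l ?lerD2r// addr_ge0// ltW.
  exists l; split => //.
  - apply: le_trans l3 _; apply: le_measure; rewrite ?inE;
      [exact: mut|exact: mut|] => s [Vs] /=.
    by rewrite in_itv/= => /andP[as_ st]; split=> //=;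
      rewrite ?in_itv/= as_ (le_trans st).
  - rewrite (le_trans wtri)// (le_trans (lerD H l4))// addrA -mulrDr.
    by rewrite addrA subrK.
(* Around a point of [A] a whole interval lies in [V]; around any other point the derivative bounds
   the slope by [g + e]. *)
have Ploc s : a <= s <= b -> exists2 r, 0 < r & forall t, `|t - s| < r ->
    (forall u, `|u - s| <= `|t - s| -> V u) \/ `|w t - w s| <= (g + e) * `|t -
      s|.
  move=> /andP[as_ sb]; have [As|As] := pselect (A s).
    have /nbhs_ballP[r r0 sr] := open_nbhs_nbhs (conj oV (AV _ As)).
    exists r => // t ts; left => u us; apply: sr.
    by rewrite /ball/= distrC (le_lt_trans us).
  have asb : a < s < b.
    rewrite !lt_neqAle as_ sb !andbT; apply/andP; split; apply/eqP => E;
      apply: As;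
      right; rewrite /= -?E; [by left|by right].
  have : exists2 d, deriv_at w s d & `|d| <= g.
    by apply: contrapT => N; apply: As; left; apply: A0P => /= /(_ asb).
  case=> D wD Dg; have /nbhs_ballP[r r0 sr] := wD e e0.
  exists r => // t ts; right; have := sr (t - s).
  rewrite /ball/= sub0r normrN => /(_ ts); rewrite subrKC => H.
  rewrite -[w t - w s](subrK ((t - s) *: D)) (le_trans (ler_normD _ _))//.
  rewrite mulrDl addrC lerD// normrZ mulrC ler_wpM2r//.
have [l [l1 l2 l3 l4]] : P b.
  apply: (real_induction ab).
  - exists [::]; split => //; first by rewrite big_nil measure_ge0.
    by rewrite big_nil !subrr normr0 mulr0 addr0.
  - move=> t /andP[at_ tb] Pt; have [r r0 H] := Ploc t ltac:(by rewrite at_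
      ltW).
    exists (t + r / 2); first by rewrite ltrDl divr_gt0.
    move=> s /andP[ts sr]; apply: (Pstep t) => //; first exact: ltW.
    have ts' : `|s - t| = s - t by rewrite ger0_norm// subr_ge0 ltW.
    have [||] := H s; rewrite ts'.
    + by rewrite ltrBlDl (le_lt_trans sr)// ltrD2l ltr_pdivrMr// ltr_pMr//
        ltr1n.
    + move=> Hs; left => u /andP[tu us]; apply: Hs.
      by rewrite ger0_norm ?subr_ge0// lerD2r.
    + by right.
  - move=> s /andP[as_ sb] Pt; have [r r0 H] := Ploc s ltac:(by rewrite sb ltW).
    pose t := Num.max a (s - r / 2).
    have at_ : a <= t by rewrite le_max lexx.
    have ts : t < s by rewrite gt_max as_ ltrBlDr ltrDl divr_gt0.
    apply: (Pstep t) => //; [exact: ltW| |by apply: Pt; rewrite at_].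
    have ts' : `|t - s| = s - t by rewrite distrC ger0_norm// subr_ge0 ltW.
    have [||] := H t; rewrite ts'.
    + rewrite ltrBlDr -ltrBlDl lt_max; apply/orP; right.
      by rewrite ltrD2l ltrN2 ltr_pdivrMr// ltr_pMr// ltr1n.
    + move=> Hs; left => u /andP[tu us]; apply: Hs.
      by rewrite distrC ger0_norm ?subr_ge0// lerD2l lerN2.
    + by rewrite distrC; right.
apply: (le_trans l4).
have : \sum_(u <- l) `|w u.2 - w u.1| < e.
  apply: ac_on_seq wd _ _ _ => //.
  rewrite -lte_fin; apply: le_lt_trans l3 _; apply: le_lt_trans Vd.
  apply: le_measure; rewrite ?inE; [|exact: mV|exact: subIsetl].
  by apply: measurableI => //; exact: measurable_itv.
move=> /ltW H; rewrite (le_trans (lerD (lexx _) H))// mulrDl -addrA lerD2l.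
by rewrite -[X in _ + X]mulr1 -mulrDr /e mulfVK ?gt_eqF.
Qed.

Lemma ac_on_lipschitz a b w (g : R) : 0 <= g -> ac_on a b w ->
  {ae mu, forall t, a < t < b -> exists2 d, deriv_at w t d & `|d| <= g} ->
  forall s t, a <= s -> s <= t -> t <= b -> `|w t - w s| <= g * (t - s).
Proof.
move=> g0 acw wg s t as_ st tb; apply: ac_on_mean_value => //.
  exact: ac_onS acw.
move: wg; apply: ae_imply => u H /andP[su ut]; apply: H.
by rewrite (le_lt_trans as_)// (lt_le_trans ut).
Qed.

(** A bootstrap: the derivative bound is known only inside the ball of radius [r], but a curve that
    has stayed there has moved by at most [g * (b - a) < r], and the strict gap lets continuity
    carry it further. *)
Lemma ac_on_confined a b w (g r : R) : a <= b -> 0 <= g -> g * (b - a) < r ->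
  ac_on a b w ->
  {ae mu, forall t, a < t < b -> `|w t - w a| <= r ->
     exists2 d, deriv_at w t d & `|d| <= g} ->
  forall t, a <= t <= b -> `|w t - w a| <= g * (t - a).
Proof.
move=> ab g0 gr acw wg.
have wbnd t : a <= t -> t <= b -> (forall s, a <= s <= t -> `|w s - w a| <= r)
  ->
    `|w t - w a| <= g * (t - a).
  move=> at_ tb H; apply: ac_on_mean_value => //.
    exact: ac_onS acw.
  move: wg; apply: ae_imply => u Hu /andP[au ut]; apply: Hu.
    by rewrite au (lt_le_trans ut).
  by apply: H; rewrite !ltW.
suff P t : a <= t <= b -> `|w t - w a| <= r.
  move=> t /andP[at_ tb]; apply: wbnd => // s /andP[as_ st].
  by apply: P; rewrite as_ (le_trans st).
have r0 : 0 <= r by rewrite (le_trans _ (ltW gr))// mulr_ge0// subr_ge0.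
suff : forall s, a <= s <= b -> `|w s - w a| <= r by exact.
apply: (@real_induction _ (fun t => forall s, a <= s <= t -> `|w s - w a| <= r)
  _ _ ab).
- move=> s; rewrite -eq_le => /eqP<-; by rewrite subrr normr0.
- move=> t' /andP[at_ tb] H.
  have [d d0 Hd] := ac_on_continuous acw (e := r - g * (b - a)) ltac:(by
    rewrite subr_gt0).
  exists (Num.min b (t' + d / 2)); first by rewrite lt_min tb ltrDl divr_gt0.
  move=> u /andP[t'u]; rewrite le_min => /andP[ub ud] s /andP[as_ su].
  have [st|ts] := leP s t'; first by apply: H; rewrite as_.
  rewrite -[r](subrK (g * (b - a))) -[w s - w a](subrK (w t' - w a)).
  rewrite (le_trans (ler_normD _ _))// lerD//.
    rewrite opprB addrA subrK ltW// Hd// ?(ltW ts)// ?(le_trans su)//.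
    rewrite ltrBlDl (le_lt_trans su)// (le_lt_trans ud)// ltrD2l.
    by rewrite ltr_pdivrMr// ltr_pMr// ltr1n.
  rewrite (le_trans (wbnd _ at_ (ltW tb) H))// ler_wpM2l// lerD2r//.
  exact: ltW.
- move=> u /andP[au ub] H s /andP[as_ su].
  have [su'|us] := ltP s u; first by apply: (H s); rewrite as_ ?lexx.
  have {su us}-> : s = u by apply/eqP; rewrite eq_le su.
  apply/ler_addgt0Pr => e e0; have [d d0 Hd] := ac_on_continuous acw e0.
  pose t' := Num.max a (u - d / 2).
  have at_ : a <= t' by rewrite le_max lexx.
  have tu : t' < u by rewrite gt_max au ltrBlDr ltrDl divr_gt0.
  rewrite -[w u - w a](subrK (w t' - w a)) addrC (le_trans (ler_normD _ _))//
    lerD//.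
    by apply: (H t'); rewrite at_ ?lexx// tu.
  rewrite opprB addrA subrK ltW// Hd// ?(ltW tu)//.
  rewrite ltrBlDr -ltrBlDl lt_max; apply/orP; right.
  by rewrite ltrD2l ltrN2 ltr_pdivrMr// ltr_pMr// ltr1n.
Qed.

(** No exponential is involved: the mean value inequality from [b] bounds the supremum of [|p - q|]
    by [|p b - q b| + (L * sup + eta) * (b - a)], and [L * (b - a) <= 1/2] absorbs the supremum on
    the right. The a priori bound [B] makes it finite. *)
Lemma backward_gronwall a b p q (L eta B : R) : a <= b -> 0 <= L -> 0 <= eta ->
  L * (b - a) <= 2^-1 -> ac_on a b p -> ac_on a b q ->
  (forall t, a <= t <= b -> `|p t - q t| <= B) ->
  {ae mu, forall t, a < t < b -> exists d d', [/\ deriv_at p t d,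
      deriv_at q t d' & `|d - d'| <= L * `|p t - q t| + eta]} ->
  forall t, a <= t <= b -> `|p t - q t| <= 2 * `|p b - q b| + 2 * (eta * (b -
    a)).
Proof.
move=> ab L0 eta0 Lab acp acq pqB pq.
pose S := [set `|p t - q t| | t in [set t | a <= t <= b]].
have S0 : S !=set0 by exists `|p a - q a|, a => //=; rewrite lexx.
have hS : has_sup S by split => //; exists B => _ [t tab <-]; exact: pqB.
have Sub t : a <= t <= b -> `|p t - q t| <= sup S.
  by move=> tab; apply: ub_le_sup; [exact: hS.2|exists t].
have supS0 : 0 <= sup S by apply: le_trans (Sub a _) => //; rewrite lexx.
have Sle : sup S <= `|p b - q b| + (L * sup S + eta) * (b - a).
  apply: ge_sup => // _ [t /andP[at_ tb] <-].
  have -> : p t - q t = (p b - q b) - ((p b - q b) - (p t - q t)) by rewrite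
    subKr.
  rewrite (le_trans (ler_normB _ _))// lerD2l.
  apply: le_trans (_ : (L * sup S + eta) * (b - t) <= _); last first.
    by rewrite ler_wpM2l ?addr_ge0 ?mulr_ge0// lerD2l lerN2.
  apply: (@ac_on_lipschitz a b (fun s => p s - q s)) => //.
  - by rewrite addr_ge0// mulr_ge0.
  - exact: ac_onB.
  - move: pq; apply: ae_imply => u H /andP[au ub].
    have [|d [d' [Hd Hd' dd']]] := H; first by rewrite au.
    exists (d - d'); first exact: deriv_atB.
    by rewrite (le_trans dd')// lerD2r ler_wpM2l// Sub// !ltW.
move=> t tab; apply: le_trans (Sub _ tab) _.
have : L * (b - a) * sup S <= 2^-1 * sup S by rewrite ler_wpM2r.
lra.
Qed.

(** Translation invariance: the pushforward of [mu] under the translation agrees with [mu] on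
    half-open intervals, hence everywhere. It serves to move a trajectory of [X] to the window where
    its control is replayed. *)
Lemma ae_shift (P : R -> Prop) c : {ae mu, forall t, P t} ->
  {ae mu, forall t, P (t - c)}.
Proof.
move=> [A [mA A0 PA]].
pose f : measurableTypeR R -> measurableTypeR R := fun t : R => t - c.
have mf : measurable_fun setT f.
  by apply: measurable_funB => //; exact: measurable_cst.
pose f' : {mfun measurableTypeR R >-> measurableTypeR R} := mfun_Sub (mem_set
  mf).
exists (f @^-1` A); split.
- by rewrite -[X in measurable X]setTI; exact: (mf measurableT _ mA).
- rewrite -A0; apply/esym.
  apply: (@lebesgue_measure_unique R (pushforward mu f')) => // _ [[x y] _ <-].
  have fE : f @^-1` `]x, y] = `]x + c, y + c]%classic.
    by apply/seteqP; split => t /=; rewrite !in_itv/= /f ltrBrDr lerBlDr.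
  change (mu `]x, y]%classic = mu (f @^-1` `]x, y]%classic)); rewrite fE.
  rewrite [LHS]lebesgue_measure_itv [RHS]lebesgue_measure_itv/= !lte_fin ltrD2r.
  by case: ifP => // _; rewrite -!EFinD opprD addrACA subrr addr0.
- by move=> t /= Pt; apply: PA.
Qed.
End MeanValue.

(** * Caratheodory solutions by Picard iteration *)

Section Primitive.
Context {R : realType}.
Notation mu := (@lebesgue_measure R).
Implicit Types (g h : R -> R) (tau D : R).

(** Cutting the integrand off outside the window makes the primitive Lipschitz on the whole line,
    with base point [-oo], the form in which the fundamental theorem [FTC1Ny] applies. *)
Definition prim tau g (s : R) : R :=
  \int[mu]_(t in `]-oo, s]) (g \_ `[0, tau]) t.

Lemma integrable_window tau g D : measurable_fun setT g ->
  (forall t, 0 <= t <= tau -> `|g t| <= D) ->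
  mu.-integrable setT (EFin \o (g \_ `[0, tau])).
Proof.
move=> mg gD; rewrite -restrict_EFin -integrable_mkcond//.
apply: measurable_bounded_integrable => //.
- by rewrite /= lebesgue_measure_itv/= -EFinD -(fun_if EFin) ltry.
- exact: measurable_funTS.
- exists D; split; first exact: num_real.
  move=> B DB t /=; rewrite in_itv/= => tab; exact: le_trans (gD _ tab) (ltW
    DB).
Qed.

Lemma prim_lipschitz tau g D : measurable_fun setT g ->
  (forall t, 0 <= t <= tau -> `|g t| <= D) -> 0 <= D ->
  forall s t, `|prim tau g s - prim tau g t| <= D * `|s - t|.
Proof.
move=> mg gD D0.
have ig := integrable_window mg gD.
have igS A : measurable A -> mu.-integrable A (EFin \o (g \_ `[0, tau])).
  by move=> mA; exact: integrableS ig.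
suff H s t : t <= s -> `|prim tau g s - prim tau g t| <= D * (s - t).
  move=> s t; have [ts|/ltW st] := leP t s.
    by rewrite (ger0_norm (x := s - t)) ?subr_ge0// H.
  by rewrite distrC (distrC s) (ger0_norm (x := t - s)) ?subr_ge0// H.
move=> ts; rewrite /prim Rintegral_itvB//; last exact: igS.
have its : mu.-integrable `]t, s] (EFin \o (g \_ `[0, tau])) by exact: igS.
apply: le_trans (le_normr_Rintegral _ its) _ => //.
have mts : fine (mu `]t, s]) = s - t.
  rewrite lebesgue_measure_itv/= lte_fin; case: ltP => //= st.
  by apply/esym/eqP; rewrite subr_eq0 eq_le st ts.
rewrite -mts -(Rintegral_cst mu)//; apply: le_Rintegral => //.
- exact: (integrable_abse its).
- apply: measurable_bounded_integrable => //.
  + by rewrite /= lebesgue_measure_itv/= -EFinD -(fun_if EFin) ltry.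
  + exists D; split; first exact: num_real.
    by move=> B DB u /= _; rewrite ger0_norm// ltW.
- move=> u _; rewrite patchE; case: ifPn; last by rewrite normr0.
  by rewrite inE/= in_itv/= => /gD.
Qed.

Lemma primB tau g h D : measurable_fun setT g -> measurable_fun setT h ->
  (forall t, 0 <= t <= tau -> `|g t| <= D) ->
  (forall t, 0 <= t <= tau -> `|h t| <= D) ->
  forall s, prim tau g s - prim tau h s = prim tau (fun t => g t - h t) s.
Proof.
move=> mg mh gD hD s; rewrite /prim -RintegralB//; last 2 first.
- by apply: integrableS (integrable_window mg gD).
- by apply: integrableS (integrable_window mh hD).
apply: eq_Rintegral => t _; rewrite !patchE; case: ifP => // _.
by rewrite subrr.
Qed.

Lemma prim_derive tau g D : measurable_fun setT g ->
  (forall t, 0 <= t <= tau -> `|g t| <= D) ->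
  {ae mu, forall t, 0 < t < tau -> is_derive t (1 : R) (prim tau g) (g t)}.
Proof.
move=> mg gD; have ig := integrable_window mg gD.
have := @FTC1Ny R (g \_ `[0, tau]) _ (open_integrable_locally openT ig).
have H y : mu.-integrable `]-oo, y] (EFin \o (g \_ `[0, tau])).
  exact: integrableS ig.
move=> /(_ H); apply: ae_imply => t [dF F't] /andP[t0 tt].
apply: DeriveDef; first exact: dF.
move: F't; rewrite derive1E => ->; rewrite patchE mem_set//=.
by rewrite in_itv/= !ltW.
Qed.
End Primitive.

Section Picard.
Context {R : realType} {n : nat}.
Notation mu := (@lebesgue_measure R).
Variables (f : R -> 'rV[R]_n -> 'rV[R]_n) (M L tau : R) (y : 'rV[R]_n).
Hypotheses (M0 : 0 <= M) (L0 : 0 <= L) (tau0 : 0 <= tau) (Ltau : L * tau <=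
  2^-1).
Let lip (z : R -> 'rV[R]_n) := forall s t, `|z s - z t| <= M * `|s - t|.
Hypothesis fM : forall s x, `|f s x| <= M.
Hypothesis fL : forall s x x', `|f s x - f s x'| <= L * `|x - x'|.
(** Measurability is asked along [M]-Lipschitz curves, a class that the iteration preserves. *)
Hypothesis fm : forall z, lip z ->
  forall j, measurable_fun setT (fun s => f s (z s) ord0 j).

(** Every clamped time is within [tau] of the terminal time, so the contraction estimates hold
    uniformly on the whole line. *)
Let cl (s : R) := Num.max 0 (Num.min s tau).

Let cl_lip s t : `|cl s - cl t| <= `|s - t|.
Proof.
rewrite /cl /Order.min /Order.max; case: (ltP s tau) => ?;
  case: (ltP t tau) => ?;
  case: (ltP 0 s) => ?; case: (ltP 0 t) => ?; case: (ltP 0 tau) => ?;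
  rewrite ler_norml; apply/andP; split; case: (ger0P (s - t)) => ?; lra.
Qed.

Let cl_tau s : `|cl s - tau| <= tau.
Proof.
rewrite /cl /Order.min /Order.max; case: (ltP s tau) => ?; case: (ltP 0 s) => ?;
  case: (ltP 0 tau) => ?; rewrite ler_norml; apply/andP; split; move: tau0; lra.
Qed.

(** The integral is based at [tau], where the value [y] is prescribed: the equation is solved
    backward. *)
Let Phi (z : R -> 'rV[R]_n) (s : R) : 'rV[R]_n :=
  \row_j (y ord0 j + prim tau (fun u => f u (z u) ord0 j) (cl s)
          - prim tau (fun u => f u (z u) ord0 j) tau).

Let fjM z j t : 0 <= t <= tau -> `|f t (z t) ord0 j| <= M.
Proof. by move=> _; exact: le_trans (row_norm_coord _ _) (fM _ _). Qed.

Let Phi_lip z : lip z -> lip (Phi z).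
Proof.
move=> lz s t; apply: row_norm_le => [|j]; first by rewrite mulr_ge0.
rewrite !mxE [X in `|X|](_ : _ = prim tau (fun u => f u (z u) ord0 j) (cl s) -
  prim tau (fun u => f u (z u) ord0 j) (cl t)); last by ring.
apply: le_trans (prim_lipschitz (fm lz j) (fjM z j) M0 _ _) _.
by rewrite ler_wpM2l.
Qed.

Let Phi_contract z z' D : 0 <= D -> lip z -> lip z' ->
  (forall s, `|z s - z' s| <= D) -> forall s, `|Phi z s - Phi z' s| <= D / 2.
Proof.
move=> D0 lz lz' zz' s; apply: row_norm_le => [|j]; first by rewrite divr_ge0.
rewrite !mxE; set g := fun u => _; set h := fun u => f u (z' u) _ _.
have -> : y ord0 j + prim tau g (cl s) - prim tau g tau -
    (y ord0 j + prim tau h (cl s) - prim tau h tau) =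
    (prim tau g (cl s) - prim tau h (cl s)) - (prim tau g tau - prim tau h tau).
  by ring.
have gh := primB (fm lz j) (fm lz' j) (fjM z j) (fjM z' j).
rewrite !gh.
apply: le_trans (_ : L * D * tau <= _); last first.
  by rewrite mulrAC mulrC ler_wpM2l.
apply: le_trans (prim_lipschitz (D := L * D) _ _ _ _ _) _.
- by apply: measurable_funB; exact: fm.
- move=> t _; rewrite /g /h.
  have := row_norm_coord (f t (z t) - f t (z' t)) j; rewrite !mxE => H.
  apply: le_trans H _; apply: le_trans (fL _ _ _) _.
  by rewrite ler_wpM2l.
- by rewrite mulr_ge0.
- by rewrite ler_wpM2l// mulr_ge0.
Qed.

Let zk (k : nat) := iter k Phi (fun=> y).

Let zk_lip k : lip (zk k).
Proof.
elim: k => [|k IH]; last exact: Phi_lip.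
by move=> s t /=; rewrite subrr normr0 mulr_ge0.
Qed.

Let D0 := M * tau.
Let D00 : 0 <= D0. Proof. by rewrite mulr_ge0. Qed.

Let Dk0 k : 0 <= D0 / 2 ^+ k. Proof. by rewrite divr_ge0// exprn_ge0. Qed.

Let zk_step k s : `|zk k.+1 s - zk k s| <= D0 / 2 ^+ k.
Proof.
elim: k s => [|k IH] s.
  rewrite expr0 divr1; apply: row_norm_le => // j; rewrite !mxE/=.
  rewrite [X in `|X|](_ : _ = prim tau (fun u => f u y ord0 j) (cl s) -
    prim tau (fun u => f u y ord0 j) tau); last by ring.
  apply: le_trans (prim_lipschitz (fm (zk_lip 0) j) (fjM _ j) M0 _ _) _.
  by rewrite ler_wpM2l.
rewrite exprS invfM mulrCA mulrC; exact: (Phi_contract (Dk0 k) (zk_lip k.+1)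
  (zk_lip k) IH).
Qed.

Let zk_cauchy k m s : `|zk (m + k) s - zk k s| <= 2 * (D0 / 2 ^+ k).
Proof.
(* The exact geometric sum is kept, since the weaker bound would not pass through the induction. *)
suff : `|zk (m + k) s - zk k s| <= 2 * (D0 / 2 ^+ k) - 2 * (D0 / 2 ^+ (m + k)).
  by move=> /le_trans; apply; rewrite gerBl mulr_ge0.
elim: m => [|m IH]; first by rewrite !subrr normr0.
rewrite -[X in `|X|](subrKA (zk (m + k) s)) (le_trans (ler_normD _ _))//.
apply: le_trans (lerD (zk_step _ _) IH) _.
rewrite addSn exprS invfM.
by lra.
Qed.

Let zlim (s : R) : 'rV[R]_n := \row_j limn (fun k => zk k s ord0 j).

Let zk_cvg s j : (fun k => zk k s ord0 j) @ \oo --> zlim s ord0 j.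
Proof.
rewrite mxE; apply/cauchy_cvgP/cauchy_exP => e e0.
have [k ke] : exists k, 2 * (D0 / 2 ^+ k) < e.
  have : (fun k => 2 * D0 * (2^-1) ^+ k) @ \oo --> (0 : R).
    by apply: cvg_geometric; rewrite ger0_norm ?invr_ge0// invf_lt1// ltr1n.
  move/cvgrPdist_lt => /(_ e e0)[k _ /(_ k (leqnn k))].
  rewrite sub0r normrN ger0_norm ?mulr_ge0 ?exprn_ge0 ?invr_ge0//.
  by rewrite exprVn -mulrA => ?; exists k.
exists (zk k s ord0 j).
suff : \forall i \near \oo, ball (zk k s ord0 j) e (zk i s ord0 j) by [].
exists k => //= i ki.
rewrite /ball/= distrC; apply: le_lt_trans ke; rewrite -(subnK ki).
have := row_norm_coord (zk (i - k + k) s - zk k s) j; rewrite !mxE => H.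
exact: (le_trans H (zk_cauchy _ _ _)).
Qed.

Let zlim_dist k s : `|zlim s - zk k s| <= 2 * (D0 / 2 ^+ k).
Proof.
apply: row_norm_le => [|j]; first by rewrite mulr_ge0.
have H : (fun m => zk m s ord0 j - zk k s ord0 j) @ \oo --> zlim s ord0 j - zk
  k s ord0 j.
  by apply: cvgB; [exact: zk_cvg|exact: cvg_cst].
rewrite mxE [X in _ + X]mxE.
apply: (cvgr_to_le (cvg_norm H)); near=> m.
have km : (k <= m)%N by near: m; exists k.
have := row_norm_coord (zk m s - zk k s) j; rewrite mxE [X in _ + X]mxE.
by move=> /le_trans; apply; rewrite -(subnK km) zk_cauchy.
Unshelve. all: by end_near. Qed.

Let zlim_lip : lip zlim.
Proof.
move=> s t; apply: row_norm_le => [|j]; first by rewrite mulr_ge0.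
rewrite mxE [X in _ + X]mxE.
apply: (cvgr_to_le (cvg_norm (cvgB (@zk_cvg s j) (@zk_cvg t j)))); near=> m.
have := row_norm_coord (zk m s - zk m t) j; rewrite mxE [X in _ + X]mxE.
by move=> /le_trans; apply; exact: zk_lip.
Unshelve. all: by end_near. Qed.

Let zlim_fixed s : zlim s = Phi zlim s.
Proof.
apply/eqP; rewrite -subr_eq0 -normr_le0; apply/ler_addgt0Pr => e e0.
have : (fun k => 2 * D0 * (2^-1) ^+ k) @ \oo --> (0 : R).
  by apply: cvg_geometric; rewrite ger0_norm ?invr_ge0// invf_lt1// ltr1n.
move/cvgrPdist_lt => /(_ e e0)[k _ /(_ k (leqnn k))].
rewrite sub0r normrN ger0_norm ?mulr_ge0 ?exprn_ge0 ?invr_ge0//.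
rewrite exprVn -mulrA => ke.
rewrite add0r; apply: le_trans (ltW ke).
(* Both distances to [zk k.+1 = Phi (zk k)] are at most [D0 / 2 ^+ k]. *)
rewrite -(subrKA (zk k.+1 s)) (le_trans (ler_normD _ _))//.
have h1 := zlim_dist k.+1 s.
have h2 : `|zk k.+1 s - Phi zlim s| <= 2 * (D0 / 2 ^+ k) / 2.
  by apply: Phi_contract => // [|u]; [rewrite mulr_ge0|rewrite distrC
    zlim_dist].
move: h1 h2; rewrite exprS invfM mulrCA; lra.
Qed.

Lemma picard_exists : exists z : R -> 'rV[R]_n, [/\ z tau = y,
  forall s t, `|z s - z t| <= M * `|s - t| &
  {ae mu, forall s, 0 < s < tau -> deriv_at z s (f s (z s))}].
Proof.
exists zlim; split => //.
- rewrite zlim_fixed; apply/rowP => j; rewrite mxE.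
  have -> : cl tau = tau by rewrite /cl minxx max_r.
  by rewrite addrK.
- have H : {ae mu, forall s j, 0 < s < tau -> is_derive s (1 : R)
    (prim tau (fun u => f u (zlim u) ord0 j)) (f s (zlim s) ord0 j)}.
    apply: filter_forall => //.
    move=> j; exact: (prim_derive (fm zlim_lip j) (fjM zlim j)).
  move: H; apply: ae_imply => s H s0.
  apply: deriv_at_row => j e e0; have := is_derive_deriv_at (H j s0) e0.
  case/andP: s0 => s0 st.
  move=> {}H; near=> h.
  have zE t : zlim t ord0 j = Phi zlim t ord0 j by rewrite [in LHS]zlim_fixed.
  rewrite !zE [X in X - _ - _]mxE [X in _ - X - _]mxE.
  have cls : cl s = s by rewrite /cl min_l ?max_r ?ltW.
  have clsh : cl (s + h) = s + h.
    have hs : `|h| < s by near: h; apply: (@nbhs0_lt R R^o).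
    have hts : `|h| < tau - s by near: h; apply: (@nbhs0_lt R R^o);
      rewrite subr_gt0.
    move: hs hts; rewrite !ltr_norml => /andP[? ?] /andP[? ?].
    by rewrite /cl min_l ?max_r//; lra.
  rewrite cls clsh [X in `|X - _|](_ : _ =
    prim tau (fun u => f u (zlim u) ord0 j) (s + h) -
    prim tau (fun u => f u (zlim u) ord0 j) s); last by ring.
  by near: h.
Unshelve. all: by end_near. Qed.
End Picard.

(** * Taylor coefficients of analytic functions *)

Section Monomials.
Context {R : realType} {n : nat}.
Local Notation mindex := {ffun 'I_n -> nat}.
Implicit Types (h : 'rV[R]_n) (al be : mindex) (m : R * mindex) (r rho : R).

Definition mdeg al : nat := (\sum_i al i)%N.

Definition mono m h : R := m.1 * \prod_i h ord0 i ^+ m.2 i.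

(** Formal partial derivative. When the exponent is 0 the subtraction truncates, but the coefficient
    then vanishes. *)
Definition dmono (i : 'I_n) m : R * mindex :=
  (m.1 * (m.2 i)%:R, [ffun k => (m.2 k - (k == i))%N]).

Lemma prodX_le al h r : `|h| <= r -> `|\prod_i h ord0 i ^+ al i| <= r ^+ mdeg
  al.
Proof.
move=> hr; have r0 : 0 <= r by exact: le_trans hr.
rewrite normr_prod /mdeg expr_sum; apply: ler_prod => i _.
rewrite normr_ge0 normrX lerXn2r ?nnegrE//.
exact: le_trans (row_norm_coord _ _) hr.
Qed.

Lemma mono_le m h r : `|h| <= r -> `|mono m h| <= `|m.1| * r ^+ mdeg m.2.
Proof. by move=> hr; rewrite normrM ler_wpM2l// prodX_le. Qed.

(** This absorbs the polynomial factors produced by differentiation: a bound at the larger radius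
    [2 * r] or [4 * r] pays for them. *)
Lemma natr_le_pow2 k : k%:R <= 2 ^+ k :> R.
Proof. by rewrite -natrX ler_nat ltnW// ltn_expl. Qed.

(** The factor [r] on the left replaces the usual exponent [k - 1] by [k], so [k = 0] needs no
    separate statement and nothing is divided by [r]. In [pow_second_order] the factor [r ^+ 2] does
    the same. *)
Lemma pow_lipschitz (a b r : R) k : `|a| <= r -> `|b| <= r ->
  r * `|a ^+ k - b ^+ k| <= k%:R * r ^+ k * `|a - b|.
Proof.
move=> ar br; have r0 : 0 <= r by exact: le_trans ar.
elim: k => [|k IH]; first by rewrite !expr0 subrr normr0 mulr0 !mul0r.
have -> : a ^+ k.+1 - b ^+ k.+1 = a * (a ^+ k - b ^+ k) + (a - b) * b ^+ k.
  by rewrite !exprS; ring.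
apply: le_trans (ler_wpM2l r0 (ler_normD _ _)) _; rewrite !normrM mulrDr.
have h1 : r * (`|a| * `|a ^+ k - b ^+ k|) <= r * (k%:R * r ^+ k * `|a - b|).
  rewrite mulrCA; apply: le_trans (ler_wpM2r _ ar) _; rewrite ?mulr_ge0//.
  by rewrite ler_wpM2l.
have h2 : r * (`|a - b| * `|b ^+ k|) <= r * (`|a - b| * r ^+ k).
  by rewrite ler_wpM2l// ler_wpM2l// normrX lerXn2r ?nnegrE.
apply: le_trans (lerD h1 h2) _.
by rewrite -natr1 exprS le_eqVlt; apply/orP; left; apply/eqP; ring.
Qed.

Lemma pow_second_order (a t r : R) k : `|a| <= r -> `|a + t| <= r ->
  r ^+ 2 * `|(a + t) ^+ k - a ^+ k - t * (k%:R * a ^+ k.-1)|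
    <= k%:R ^+ 2 * t ^+ 2 * r ^+ k.
Proof.
move=> ar atr; have r0 : 0 <= r by exact: le_trans ar.
elim: k => [|k IH].
  by rewrite !expr0 subrr mul0r mulr0 subrr normr0 mulr0 expr0n/= !mul0r.
rewrite [k.+1.-1]/=.
set E := (a + t) ^+ k - _ - _ in IH.
have -> : (a + t) ^+ k.+1 - a ^+ k.+1 - t * (k.+1%:R * a ^+ k) =
   (a + t) * E + k%:R * t ^+ 2 * a ^+ k.-1.
  rewrite /E; case: (k) => [|j]; first by rewrite !expr0 !expr1; ring.
  by rewrite /= !exprS -!natr1; ring.
apply: le_trans (ler_wpM2l (exprn_ge0 2 r0) (ler_normD _ _)) _.
rewrite (normrM (a + t)) mulrDr.
have h1 : r ^+ 2 * (`|a + t| * `|E|) <= r * (k%:R ^+ 2 * t ^+ 2 * r ^+ k).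
  rewrite mulrCA; apply: le_trans (ler_wpM2r _ atr) _.
    by rewrite mulr_ge0// exprn_ge0.
  by rewrite ler_wpM2l.
have kt0 : 0 <= k%:R * t ^+ 2 by rewrite mulr_ge0// sqr_ge0.
have h2 : r ^+ 2 * `|k%:R * t ^+ 2 * a ^+ k.-1| <= k%:R * t ^+ 2 * r ^+ k.+1.
  rewrite normrM (ger0_norm kt0) mulrCA.
  case: (k) kt0 => [|j] /= kt0; first by rewrite !mul0r.
  rewrite ler_wpM2l// -[j.+2]/(2 + j)%N exprD ler_wpM2l ?exprn_ge0//.
  by rewrite normrX lerXn2r ?nnegrE.
apply: le_trans (lerD h1 h2) _; rewrite -subr_ge0.
rewrite [leRHS](_ : _ = (k%:R + 1) * t ^+ 2 * r ^+ k.+1); last first.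
  by rewrite -natr1 (exprS r k); ring.
have k1 : 0 <= k%:R + 1 :> R by rewrite addr_ge0.
exact: mulr_ge0 (mulr_ge0 k1 (sqr_ge0 t)) (exprn_ge0 _ r0).
Qed.

(** Errors are measured relative to the bounds [w i], so that they simply add up in a product. *)
Lemma prod_lipschitz (I : Type) (s : seq I) (a b e : I -> R) (w : I -> R) :
  (forall i, `|a i| <= w i) -> (forall i, `|b i| <= w i) ->
  (forall i, 0 <= e i) ->
  (forall i, `|a i - b i| <= e i * w i) ->
  `|\prod_(i <- s) a i - \prod_(i <- s) b i|
    <= (\sum_(i <- s) e i) * \prod_(i <- s) w i.
Proof.
move=> aw bw e0 abe; have w0 i : 0 <= w i by exact: le_trans (aw i).
elim: s => [|i s IH]; first by rewrite !big_nil subrr normr0 mul0r.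
rewrite !big_cons.
set A := \prod_(j <- s) a j in IH *; set B := \prod_(j <- s) b j in IH *.
set W := \prod_(j <- s) w j in IH *.
have W0 : 0 <= W by apply: prodr_ge0.
have BW : `|B| <= W.
  by rewrite /B normr_prod; apply: ler_prod => j _; rewrite normr_ge0 bw.
have -> : a i * A - b i * B = a i * (A - B) + (a i - b i) * B by ring.
apply: le_trans (ler_normD _ _) _; rewrite !normrM.
have h1 := ler_pM (normr_ge0 _) (normr_ge0 _) (aw i) IH.
have h2 := ler_pM (normr_ge0 _) (normr_ge0 _) (abe i) BW.
apply: le_trans (lerD h1 h2) _.
by rewrite le_eqVlt; apply/orP; left; apply/eqP; ring.
Qed.

Lemma mono_lipschitz m h h' r : `|h| <= r -> `|h'| <= r ->
  r * `|mono m h - mono m h'| <= `|m.1| * (2 * r) ^+ mdeg m.2 * `|h - h'|.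
Proof.
move=> hr hr'; have r0 : 0 <= r by exact: le_trans hr.
have [r00|rn0] := eqVneq r 0.
  rewrite r00 mul0r !mulr_ge0// exprn_ge0// mulr0//.
have rp : 0 < r by rewrite lt_neqAle eq_sym rn0.
rewrite /mono -mulrBr normrM mulrCA -mulrA ler_wpM2l//.
rewrite mulrC -ler_pdivlMr//.
(* The relative error of the [i]-th power is [m.2 i * |h - h'| / r]; the exponents sum to the
   degree, which is at most [2 ^+ mdeg m.2]. *)
have := @prod_lipschitz _ (index_enum 'I_n) (fun i => h ord0 i ^+ m.2 i)
  (fun i => h' ord0 i ^+ m.2 i) (fun i => (m.2 i)%:R * `|h - h'| / r)
  (fun i => r ^+ m.2 i).
move=> /(_ _ _ _ _)/le_trans; apply.
- by move=> i; rewrite normrX lerXn2r ?nnegrE// (le_trans (row_norm_coord _ _)).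
- by move=> i; rewrite normrX lerXn2r ?nnegrE// (le_trans (row_norm_coord _ _)).
- by move=> i; rewrite !mulr_ge0 ?invr_ge0.
- move=> i; rewrite mulrAC ler_pdivlMr// mulrC.
  have hi : `|h ord0 i| <= r by exact: le_trans (row_norm_coord _ _) hr.
  have hi' : `|h' ord0 i| <= r by exact: le_trans (row_norm_coord _ _) hr'.
  apply: le_trans (pow_lipschitz _ hi hi') _; rewrite mulrAC ler_wpM2r
    ?exprn_ge0//.
  rewrite ler_wpM2l//; have := row_norm_coord (h - h') i; by rewrite !mxE.
- rewrite -mulr_suml -mulr_suml -expr_sum -natr_sum -/(mdeg m.2).
  rewrite mulrAC ler_wpM2r ?invr_ge0// mulrAC ler_wpM2r//.
  by rewrite exprMn ler_wpM2r ?exprn_ge0// natr_le_pow2.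
Qed.

(** Only coordinate [i] moves, so the remainder is a one-variable remainder times the untouched
    powers. *)
Lemma mono_dmonoE (i : 'I_n) m h (t : R) :
  mono m (h + t *: delta_mx ord0 i) - mono m h - t * mono (dmono i m) h =
  m.1 * ((h ord0 i + t) ^+ m.2 i - h ord0 i ^+ m.2 i
         - t * ((m.2 i)%:R * h ord0 i ^+ (m.2 i).-1))
      * \prod_(j | j != i) h ord0 j ^+ m.2 j.
Proof.
rewrite /mono /dmono/=.
rewrite !(bigD1 (P := xpredT) i)//= !mxE !eqxx/= mulr1 ffunE eqxx subn1.
have -> : \prod_(j < n | j != i) (h + t *: delta_mx ord0 i) ord0 j ^+ m.2 j =
          \prod_(j < n | j != i) h ord0 j ^+ m.2 j.
  by apply: eq_bigr => j ji; rewrite !mxE (negbTE ji) andbF mulr0 addr0.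
have -> : \prod_(j < n | j != i) h ord0 j ^+ [ffun k => (m.2 k - (k == i))%N] j
  =
          \prod_(j < n | j != i) h ord0 j ^+ m.2 j.
  by apply: eq_bigr => j ji; rewrite ffunE (negbTE ji) subn0.
ring.
Qed.

Lemma mono_second_order (i : 'I_n) m h (t r : R) : `|h| <= r ->
  `|h ord0 i + t| <= r ->
  r ^+ 2 * `|mono m (h + t *: delta_mx ord0 i) - mono m h - t * mono (dmono i
    m) h|
   <= t ^+ 2 * (`|m.1| * (4 * r) ^+ mdeg m.2).
Proof.
move=> hr htr; have r0 : 0 <= r by exact: le_trans hr.
rewrite mono_dmonoE normrM normrM.
have hi : `|h ord0 i| <= r by exact: le_trans (row_norm_coord _ _) hr.
have h1 := pow_second_order (m.2 i) hi htr.
have h2 : `|\prod_(j | j != i) h ord0 j ^+ m.2 j| <= \prod_(j | j != i) (4 * r)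
  ^+ m.2 j.
  rewrite normr_prod; apply: ler_prod => j _; rewrite normr_ge0 normrX.
  rewrite lerXn2r ?nnegrE ?mulr_ge0// (le_trans (row_norm_coord _ _))//.
  by rewrite (le_trans hr)// ler_peMl// ler1n.
have h3 : (m.2 i)%:R ^+ 2 * t ^+ 2 * r ^+ m.2 i <= t ^+ 2 * (4 * r) ^+ m.2 i.
  rewrite (mulrC _ (t ^+ 2)) -mulrA ler_wpM2l ?sqr_ge0// exprMn.
  rewrite ler_wpM2r ?exprn_ge0//.
  have -> : 4 = 2 ^+ 2 :> R by rewrite -natrX.
  by rewrite -exprM mulnC exprM lerXn2r ?nnegrE ?exprn_ge0// natr_le_pow2.
rewrite /mdeg expr_sum [X in _ <= _ * (_ * X)](bigD1 i)//=.
have h4 := ler_pM (mulr_ge0 (exprn_ge0 2 r0) (normr_ge0 _)) (normr_ge0 _)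
  (le_trans h1 h3) h2.
set u := `|_ - _ - _| in h4 *; set Q := `|\prod_(_ | _) _| in h4 *.
set W := \prod_(_ | _) (4 * r) ^+ _ in h4 *.
have -> : r ^+ 2 * (`|m.1| * u * Q) = `|m.1| * (r ^+ 2 * u * Q) by ring.
have -> : t ^+ 2 * (`|m.1| * ((4 * r) ^+ m.2 i * W)) =
  `|m.1| * (t ^+ 2 * (4 * r) ^+ m.2 i * W) by ring.
by rewrite ler_wpM2l.
Qed.

Lemma dmono_size (i : 'I_n) m r : 0 < r ->
  `|(dmono i m).1| * r ^+ mdeg (dmono i m).2
    <= r^-1 * (`|m.1| * (4 * r) ^+ mdeg m.2).
Proof.
move=> r0; rewrite /dmono/= normrM normr_nat.
have rr : 0 <= r by exact: ltW.
case E : (m.2 i) => [|k].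
  by rewrite mulr0 mul0r !mulr_ge0 ?invr_ge0 ?exprn_ge0 ?mulr_ge0.
have -> : mdeg m.2 = (mdeg [ffun j => (m.2 j - (j == i))%N]).+1.
  rewrite /mdeg (bigD1 i)//= [in RHS](bigD1 i)//= ffunE eqxx E subn1 -addSn/=.
  by congr addn; apply: eq_bigr => j ji; rewrite ffunE (negbTE ji) subn0.
set d := mdeg _.
have kd : (k <= d)%N.
  by rewrite /d /mdeg (bigD1 i)//= ffunE eqxx E subn1 leq_addr.
rewrite mulrCA -mulrA ler_wpM2l// exprMn (exprSr 4) (exprSr r).
rewrite [leRHS](_ : _ = 4 ^+ d * 4 * r ^+ d); last first.
  by field; rewrite gt_eqF.
rewrite ler_wpM2r ?exprn_ge0//.
have h1 : (k.+1%:R : R) <= 2 ^+ k.+1 := natr_le_pow2 k.+1.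
apply: le_trans h1 _; rewrite -exprSr.
apply: le_trans (_ : (4 : R) ^+ k.+1 <= _).
  by rewrite lerXn2r ?nnegrE// ler_nat.
by rewrite ler_weXn2l// ler1n.
Qed.
End Monomials.

(** * Limits of polynomials with bounded coefficient size *)

Section PolynomialLimits.
Context {R : realType} {n : nat}.
Local Notation mindex := {ffun 'I_n -> nat}.
Implicit Types (h a : 'rV[R]_n) (al : mindex) (m : R * mindex) (r rho : R)
  (l : seq (R * mindex)) (f : 'rV[R]_n -> R).

Definition peval l h : R := \sum_(m <- l) mono m h.

Definition psize r l : R := \sum_(m <- l) `|m.1| * r ^+ mdeg m.2.

(* [f] is near [a] a pointwise limit of polynomials with uniformly bounded
   l^1 norm of coefficients; unlike convergence of a power series, this is
   insensitive to the order of summation and visibly stable under [partial]. *)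
Definition plimit f a rho (S : R) (L : nat -> seq (R * mindex)) :=
  [/\ 0 < rho, forall k, psize rho (L k) <= S &
      forall h, `|h| < rho -> (fun k => peval (L k) h) @ \oo --> f (a + h)].

Lemma psize_ge0 r l : 0 <= r -> 0 <= psize r l.
Proof. by move=> r0; apply: sumr_ge0 => m _; rewrite mulr_ge0// exprn_ge0. Qed.

Lemma plimit_ge0 f a rho S L : plimit f a rho S L -> 0 <= S.
Proof. by move=> [/ltW r0 H _]; exact: le_trans (psize_ge0 (L 0%N) r0) (H _).
  Qed.

Lemma plimit_bounded f a rho S L : plimit f a rho S L ->
  forall h, `|h| < rho -> `|f (a + h)| <= S.
Proof.
move=> [r0 H cf] h hr; apply: (cvgr_to_le (cvg_norm (cf h hr))); near=> k.
apply: le_trans (H k); apply: le_trans (ler_norm_sum _ _ _) _.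
by apply: ler_sum => m _; exact: mono_le (ltW hr).
Unshelve. all: by end_near. Qed.

(** Halving the radius pays for the factor [(2 * r) ^+ mdeg m.2] in [mono_lipschitz]; the resulting
    constant is uniform in [k] and survives the limit. *)
Lemma plimit_lipschitz f a rho S L : plimit f a rho S L ->
  forall h h', `|h| <= rho / 2 -> `|h'| <= rho / 2 ->
  `|f (a + h) - f (a + h')| <= 2 / rho * S * `|h - h'|.
Proof.
move=> [r0 H cf] h h' hr hr'.
have r2 : rho / 2 < rho by rewrite ltr_pdivrMr// ltr_pMr// ltr1n.
apply: (cvgr_to_le (cvg_norm (cvgB (cf h (le_lt_trans hr r2)) (cf h'
  (le_lt_trans hr' r2))))).
near=> k.
rewrite -[leRHS]mulrA -[leLHS]mul1r -[X in X * _](divff (_ : rho != 0))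
  ?gt_eqF//.
rewrite [leLHS](_ : _ = 2 / rho * (rho / 2 * `|peval (L k) h - peval (L k)
  h'|)); last first.
  by field; rewrite gt_eqF.
rewrite ler_wpM2l ?divr_ge0// ?(ltW r0)//.
apply: le_trans (_ : psize rho (L k) * `|h - h'| <= _); last first.
  by rewrite ler_wpM2r.
rewrite /peval -sumrB; apply: le_trans (ler_wpM2l _ (ler_norm_sum _ _ _)) _.
  by rewrite divr_ge0// ltW.
rewrite mulr_sumr mulr_suml; apply: ler_sum => m _.
apply: le_trans (mono_lipschitz m hr hr') _.
by rewrite mulrCA divff// mulr1.
Unshelve. all: by end_near. Qed.

(** Difference quotients and formal derivatives of the polynomials differ by at most [C * |t|],
    uniformly in [k]. A small fixed [t] thus makes [q] Cauchy, and the same bound in the limit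
    identifies the partial derivative of [f]. Of the factor 8 in the radius, 4 pays for
    [mono_second_order] and 2 leaves room for the shift by [t]. *)
Lemma plimit_partial (i : 'I_n) f a rho S L : plimit f a rho S L ->
  plimit (partial i f) a (rho / 8) (4 / rho * S) (fun k => map (dmono i) (L k)).
Proof.
move=> pl; have S0 := plimit_ge0 pl; case: pl => [r0 H cf].
pose r := rho / 4.
have rp : 0 < r by rewrite divr_gt0.
have rE : 4 * r = rho by rewrite /r mulrCA divff// mulr1.
have r8 : rho / 8 = r / 2 by rewrite /r; field.
split.
- by rewrite divr_gt0.
- move=> k; rewrite /psize big_map.
  apply: le_trans (_ : r^-1 * psize rho (L k) <= _); last first.
    by rewrite (_ : 4 / rho = r^-1) ?ler_wpM2l ?invr_ge0 ?(ltW rp)// /r invfM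
      invrK mulrC.
  rewrite mulr_sumr; apply: ler_sum => m _; rewrite r8 -rE.
  apply: le_trans (dmono_size i m rp).
  rewrite ler_wpM2l// lerXn2r ?nnegrE ?(ltW rp)//.
    by rewrite divr_ge0// ltW.
  by rewrite ler_pdivrMr// ler_peMr ?(ltW rp)// ler1n.
move=> h hr.
pose e : 'rV[R]_n := delta_mx ord0 i.
have hr' : `|h| <= r / 2 by rewrite -r8 ltW.
pose q k := peval (map (dmono i) (L k)) h.
pose C := S / r ^+ 2.
have C0 : 0 <= C by rewrite divr_ge0// exprn_ge0// ltW.
have hte (t : R) : `|t| <= r / 2 -> `|h + t *: e| <= r.
  move=> tr; rewrite (le_trans (ler_normD _ _))// (splitr r) lerD// normrZ.
  rewrite -[r / 2]mulr1; apply: ler_pM => //.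
  apply: row_norm_le => // j; rewrite mxE.
  by case: (_ && _); rewrite ?normr1 ?normr0.
have rltrho : r < rho by rewrite -rE ltr_pMl// ltr1n.
have qk k (t : R) : `|t| <= r / 2 ->
    `|peval (L k) (h + t *: e) - peval (L k) h - t * q k| <= C * t ^+ 2.
  move=> tr; rewrite /C mulrAC ler_pdivlMr ?exprn_gt0// mulrC.
  rewrite /q /peval big_map mulr_sumr -!sumrB.
  apply: le_trans (ler_wpM2l (exprn_ge0 2 (ltW rp)) (ler_norm_sum _ _ _)) _.
  rewrite mulr_sumr.
  apply: le_trans (_ : t ^+ 2 * psize rho (L k) <= _); last first.
    by rewrite mulrC ler_wpM2r ?sqr_ge0.
  rewrite /psize mulr_sumr; apply: ler_sum => m _; rewrite -rE.
  apply: mono_second_order.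
    by rewrite (le_trans hr')// ler_pdivrMr// ler_peMr ?(ltW rp)// ler1n.
  rewrite (le_trans (ler_normD _ _))// (splitr r) lerD//.
  exact: le_trans (row_norm_coord _ _) hr'.
pose Q t := t^-1 * (f (a + (h + t *: e)) - f (a + h)).
have hlt : `|h| < rho.
  by apply: le_lt_trans hr' _; rewrite ltr_pdivrMr// (lt_trans rltrho)//
    ltr_pMr// ltr1n.
have cvgQ (t : R) : `|t| <= r / 2 -> t != 0 ->
    (fun k => t^-1 * (peval (L k) (h + t *: e) - peval (L k) h)) @ \oo --> Q t.
  move=> tr t0; apply: cvgMr; apply: cvgB; apply: cf => //.
  exact: le_lt_trans (hte _ tr) _.
have qQ k (t : R) : `|t| <= r / 2 -> t != 0 ->
    `|q k - t^-1 * (peval (L k) (h + t *: e) - peval (L k) h)| <= C * `|t|.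
  move=> tr t0; have tp : 0 < `|t| by rewrite normr_gt0.
  rewrite -(ler_pM2l tp) -normrM mulrBr mulVKf// distrC.
  apply: le_trans (qk k _ tr) _.
  by rewrite -[t ^+ 2](real_normK (num_real _)) expr2 mulrCA.
have rr2 : 0 < r / 2 by rewrite divr_gt0.
have tex (eps : R) : 0 < eps -> exists t : R, [/\ `|t| <= r / 2, t != 0 & C *
  `|t| <= eps].
  move=> ep; exists (Num.min (r / 2) (eps / (C + 1))).
  have C1 : 0 < C + 1 by rewrite ltr_wpDl.
  have mp : 0 < Num.min (r / 2) (eps / (C + 1)) by rewrite lt_min rr2 divr_gt0.
  split; rewrite ?gt_eqF ?gtr0_norm ?ge_min ?lexx//.
  apply: le_trans (_ : (C + 1) * (eps / (C + 1)) <= _).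
    by rewrite ler_pM ?lerDl ?(ltW mp)// ge_min lexx orbT.
  by rewrite mulrCA divff ?mulr1// gt_eqF.
have cq : cvgn q.
  apply/cauchy_cvgP/cauchy_exP => eps ep.
  have ep2 : 0 < eps / 2 by rewrite divr_gt0.
  have [t [tr t0 tC]] := tex _ ep2.
  exists (Q t); suff : \forall k \near \oo, ball (Q t) eps (q k) by [].
  near=> k; rewrite /ball/=.
  rewrite -(subrKA (t^-1 * (peval (L k) (h + t *: e) - peval (L k) h))).
  apply: le_lt_trans (ler_normD _ _) _; rewrite (splitr eps) ltr_leD//;
    last first.
    by rewrite distrC (le_trans (qQ k t tr t0)).
  by near: k; have /cvgrPdist_lt := cvgQ t tr t0; apply.
suff -> : partial i f (a + h) = limn q by exact: cq.
apply/cvg_lim => //; apply/cvgrPdist_le => eps ep.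
near=> t.
have t0 : t != 0 by near: t; exact: nbhs_dnbhs_neq.
have tr : `|t| <= r / 2.
  by near: t; apply: nbhs_dnbhs; exact: (@nbhs0_le R R^o).
have tC : C * `|t| <= eps.
  have : `|t| <= eps / (C + 1).
    near: t; apply: nbhs_dnbhs; apply: (@nbhs0_le R R^o).
    by rewrite divr_gt0// ltr_wpDl.
  rewrite ler_pdivlMr ?ltr_wpDl// mulrDr mulr1 mulrC; apply: le_trans.
  by rewrite lerDl.
rewrite /= -/e (_ : t *: e + (a + h) = a + (h + t *: e));
  last by rewrite addrC addrA.
rewrite -[X in `|_ - X|]/(Q t).
apply: le_trans tC.
apply: (cvgr_to_le (cvg_norm (cvgB cq (cvgQ t tr t0)))); near=> k.
exact: qQ.
Unshelve. all: by end_near. Qed.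
End PolynomialLimits.

(** * Power series coefficients from iterated partial derivatives *)

Section Coefficients.
Context {R : realType} {n : nat}.
Local Notation mindex := {ffun 'I_n -> nat}.
Implicit Types (h a : 'rV[R]_n) (al : mindex) (m : R * mindex) (r rho : R)
  (l : seq (R * mindex)) (f g : 'rV[R]_n -> R) (s : seq 'I_n)
  (c : mindex -> R).

Lemma plimit_iter_partial s f a rho S L : plimit f a rho S L ->
  exists rho' S', plimit (iter_partial s f) a rho' S'
    (fun k => map (fun m => foldr dmono m s) (L k)).
Proof.
move=> pl; elim: s => [|i s [rho' [S' IH]]].
  by exists rho, S; under eq_fun do rewrite map_id.
exists (rho' / 8), (4 / rho' * S').
have := plimit_partial i IH.
by under eq_fun do rewrite -map_comp.
Qed.

(** Product of the falling factorials of the exponents, with lengths the multiplicities in [s].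
    Truncated subtraction makes it 0 once a variable is differentiated more often than its
    exponent. *)
Fixpoint dweight s al : nat :=
  if s is i :: s' then (dweight s' al * (al i - count_mem i s'))%N else 1%N.

Lemma foldr_dmono s m : foldr dmono m s =
  (m.1 * (dweight s m.2)%:R, [ffun k => (m.2 k - count_mem k s)%N]).
Proof.
elim: s => [|i s IH].
  rewrite mulr1 [LHS]surjective_pairing; congr pair.
  by apply/ffunP => k; rewrite ffunE subn0.
rewrite /= IH /dmono/= ffunE natrM mulrA; congr pair.
by apply/ffunP => k; rewrite !ffunE eq_sym; case: eqP => _ /=; lia.
Qed.

Lemma dweight_gt0 s al :
  (0 < dweight s al)%N = [forall k, (count_mem k s <= al k)%N].
Proof.
elim: s => [|i s IH]; first by apply/esym/forallP.
rewrite /= muln_gt0 IH subn_gt0; apply/andP/forallP.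
  move=> [/forallP H H'] k; rewrite /=; case: eqP => [<-|_] /=;
    first by rewrite add1n.
  by rewrite add0n.
move=> H; split; first by apply/forallP => k; have := H k; rewrite /=; lia.
by have := H i; rewrite /= eqxx.
Qed.

Lemma mono0 m : mono m (0 : 'rV[R]_n) = m.1 * [forall k, m.2 k == 0%N]%:R.
Proof.
rewrite /mono; congr (_ * _).
case: forallP => H.
  by rewrite big1// => i _; rewrite (eqP (H i)) expr0.
have [i mi] : exists i, m.2 i != 0%N.
  by apply: contrapT => N; apply: H => i; apply/negPn/negP => mi; apply: N;
    exists i.
by rewrite (bigD1 i)//= mxE expr0n (negbTE mi) mul0r.
Qed.

Definition mseq al : seq 'I_n := flatten [seq nseq (al i) i | i <- enum 'I_n].

Lemma count_mseq al k : count_mem k (mseq al) = al k.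
Proof.
rewrite /mseq count_flatten -map_comp.
rewrite (eq_map (g := fun i => if i == k then al k else 0%N)); last first.
  by move=> i; rewrite /= count_nseq /=; case: eqP => [->|_];
    rewrite ?mul1n ?mul0n.
by rewrite sumnE big_map -big_mkcond big_enum_cond/= big_pred1_eq.
Qed.

Lemma size_mseq al : size (mseq al) = mdeg al.
Proof.
rewrite size_flatten /shape -map_comp sumnE big_map big_enum/=.
by apply: eq_bigr => i _; rewrite size_nseq.
Qed.

Definition box_index (k : nat) (be : {ffun 'I_n -> 'I_k}) : mindex :=
  [ffun i => nat_of_ord (be i)].

(** The terms of the [k]-th partial sum in [analytic_at]: [plimit] with [box c] is convergence of
    that power series. *)
Definition box c (k : nat) : seq (R * mindex) :=
  [seq (c (box_index be), box_index be) | be <- enum {ffun 'I_n -> 'I_k}].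

Lemma box_index_inj k : injective (@box_index k).
Proof.
move=> be be' /ffunP H; apply/ffunP => i; have := H i; rewrite !ffunE.
exact: val_inj.
Qed.

Lemma sum_box (F : R * mindex -> R) c k : \sum_(m <- box c k) F m =
  \sum_(be : {ffun 'I_n -> 'I_k}) F (c (box_index be), box_index be).
Proof. by rewrite big_map big_enum. Qed.

(** At the centre a differentiated monomial survives only if no positive power is left, while an
    exponent smaller than in [al] gives weight 0. Only the index [al] remains, and the sequence is
    constant once the box contains it. *)
Lemma coefficient_partial f a rho S c al : plimit f a rho S (box c) ->
  iter_partial (mseq al) f a = c al * (dweight (mseq al) al)%:R.
Proof.
move=> /(plimit_iter_partial (mseq al))[rho' [S' [r0 _ cf]]].
have := cf 0; rewrite normr0 addr0 => /(_ r0) {}cf.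
apply: (cvg_unique (@Rhausdorff R) cf); apply: cvg_near_cst.
exists (\max_i al i).+1 => // k /= alk.
have alk' i : (al i < k)%N by rewrite (leq_trans _ alk)// ltnS leq_bigmax.
pose be0 : {ffun 'I_n -> 'I_k} := [ffun i => Ordinal (alk' i)].
have be0E : box_index be0 = al by apply/ffunP => i; rewrite !ffunE.
rewrite /peval big_map sum_box (bigD1 be0)//= [X in _ + X]big1 ?addr0.
  rewrite be0E mono0 foldr_dmono/=.
  case: forallP => [_|[] i]; first by rewrite mulr1.
  by rewrite ffunE count_mseq subnn.
move=> be bebe0; rewrite mono0 foldr_dmono/=.
case: forallP => [H|_]; last by rewrite mulr0.
case: (posnP (dweight (mseq al) (box_index be))) => [->|];
  first by rewrite mulr0 mul0r.
rewrite dweight_gt0 => /forallP H'; case/eqP: bebe0; apply: box_index_inj.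
rewrite be0E; apply/ffunP => i; apply/eqP; rewrite eqn_leq.
have h1 := H i; have h2 := H' i.
rewrite (ffunE (fun k => _)) count_mseq subn_eq0 in h1;
  rewrite count_mseq in h2.
by rewrite h1 h2.
Qed.

Lemma dweight_mseq al : (dweight (mseq al) al)%:R != 0 :> R.
Proof.
by rewrite pnatr_eq0 -lt0n dweight_gt0; apply/forallP => k; rewrite count_mseq.
Qed.

Lemma plimit_shrink f a rho rho' S L : 0 < rho' -> rho' <= rho ->
  plimit f a rho S L -> plimit f a rho' S L.
Proof.
move=> r'0 r'r [r0 H cf]; split=> // [k|h hr]; last first.
  by apply: cf; exact: lt_le_trans r'r.
apply: le_trans (H k); apply: ler_sum => m _; rewrite ler_wpM2l//.
by rewrite lerXn2r// nnegrE ltW.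
Qed.

(** Terms of degree below [N] cancel. For the others [|h| < rho] gives [(|h| / rho) ^+ mdeg al <=
    (|h| / rho) ^+ N], and the coefficient sizes add up to at most [S + S']. *)
Lemma plimit_diff f g a rho S S' c c' (N : nat) :
  plimit f a rho S (box c) -> plimit g a rho S' (box c') ->
  (forall al, (mdeg al < N)%N -> c al = c' al) ->
  forall h, `|h| < rho ->
    `|f (a + h) - g (a + h)| <= (S + S') / rho ^+ N * `|h| ^+ N.
Proof.
move=> [r0 H cf] [_ H' cg] cc h hr.
apply: (cvgr_to_le (cvg_norm (cvgB (cf h hr) (cg h hr)))); near=> k.
rewrite mulrAC -mulrA -expr_div_n.
apply: le_trans (_ : (psize rho (box c k) + psize rho (box c' k)) *
    (`|h| / rho) ^+ N <= _); last first.
  by rewrite ler_wpM2r ?exprn_ge0 ?divr_ge0 ?(ltW r0)// lerD.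
rewrite -[X in `|X| <= _]/(peval (box c k) h - peval (box c' k) h).
rewrite /peval /psize !sum_box -sumrB -big_split/= mulr_suml.
apply: le_trans (ler_norm_sum _ _ _) _; apply: ler_sum => be _.
set al := box_index be; rewrite /mono/= -mulrBl -mulrDl.
have [deg|deg] := ltnP (mdeg al) N.
  rewrite (cc _ deg) subrr mul0r normr0; have r0' := ltW r0.
  exact: mulr_ge0 (mulr_ge0 (addr_ge0 (normr_ge0 _) (normr_ge0 _))
    (exprn_ge0 _ r0')) (exprn_ge0 _ (divr_ge0 (normr_ge0 _) r0')).
rewrite normrM -mulrA; apply: ler_pM => //; first exact: ler_normB.
apply: le_trans (prodX_le al (lexx _)) _.
rewrite -[X in X ^+ mdeg al <= _](divfK (_ : rho != 0)) ?gt_eqF//.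
rewrite exprMn mulrC ler_wpM2l ?exprn_ge0 ?(ltW r0)//.
rewrite ler_wiXn2l ?divr_ge0 ?(ltW r0)// ler_pdivrMr// mul1r ltW//.
Unshelve. all: by end_near. Qed.

Lemma analytic_plimit f a : analytic_at f a ->
  exists c rho S, plimit f a rho S (box c).
Proof.
move=> [c /nbhs_ballP[d d0 Hc]].
pose rho := d / 2; have r0 : 0 < rho by rewrite divr_gt0.
have Hd h : `|h| <= rho -> ball a d (a + h).
  move=> hr; rewrite -ball_normE/= opprD addNKr normrN (le_lt_trans hr)//.
  by rewrite /rho ltr_pdivrMr// ltr_pMr// ltr1n.
have termE h al : power_term c a (a + h) al = mono (c al, al) h.
  by rewrite /power_term /mono/=; congr (_ * _); apply: eq_bigr => i _;
    rewrite !mxE addrAC subrr add0r.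
(* At this corner of the cube the term of index [al] is [c al * rho ^+ mdeg al], so absolute
   convergence at one point bounds the size of all partial sums. *)
pose hh : 'rV[R]_n := const_mx rho.
have hhr : `|hh| <= rho.
  by apply: row_norm_le => [|j]; [exact: ltW|rewrite mxE gtr0_norm].
have [sm _] := Hc _ (Hd _ hhr).
move: sm; rewrite /summable; set E := esum _ _ => Efin.
have E0 : (0 <= E)%E by apply: esum_ge0 => ? _; exact: abse_ge0.
exists c, rho, (fine E); split => //.
- move=> k; rewrite /psize sum_box -lee_fin fineK; last by rewrite ge0_fin_numE.
  apply: esum_ge; exists [set` [seq @box_index k be | be <- enum {ffun 'I_n ->
    'I_k}]].
    by split => //; exact: finite_seq.
  have us : uniq [seq @box_index k be | be <- enum {ffun 'I_n -> 'I_k}].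
    by rewrite map_inj_uniq ?enum_uniq//; exact: box_index_inj.
  rewrite -fsbig_seq//.
  rewrite big_map big_enum/= -sumEFin; apply: lee_sum => be _.
  rewrite termE lee_fin /mono/= normrM ler_wpM2l//.
  rewrite /mdeg expr_sum normr_prod; apply: ler_prod => i _.
  by rewrite mxE ler_norm andbT; apply: exprn_ge0; exact: ltW.
- move=> h hr; have [_] := Hc _ (Hd _ (ltW hr)).
  apply: cvg_trans; apply: near_eq_cvg; near=> k.
  by rewrite /peval sum_box; apply: eq_bigr => be _; rewrite termE.
Unshelve. all: by end_near. Qed.
End Coefficients.

(** * Uniform local estimates for the two families of fields *)

Section FieldEstimates.
Context {R : realType} {n : nat}.

(** The Lipschitz clause concerns [g], which will be [Y]: its equation is solved and compared by
    Gronwall, whereas the trajectories of [X] are given. *)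
Definition close_on (f g : 'rV[R]_n -> R) (a : 'rV[R]_n) (N : nat) (r B : R) :=
  [/\ forall h, `|h| <= r -> `|f (a + h)| <= B,
      forall h, `|h| <= r -> `|g (a + h)| <= B,
      forall h h', `|h| <= r -> `|h'| <= r ->
        `|g (a + h) - g (a + h')| <= B * `|h - h'| &
      forall h, `|h| <= r -> `|f (a + h) - g (a + h)| <= B * `|h| ^+ N].

Lemma close_onW f g a N r B r' B' : r' <= r -> B <= B' ->
  close_on f g a N r B -> close_on f g a N r' B'.
Proof.
move=> rr BB [H1 H2 H3 H4]; split.
- by move=> h /le_trans/(_ rr)/H1/le_trans; exact.
- by move=> h /le_trans/(_ rr)/H2/le_trans; exact.
- move=> h h' /le_trans/(_ rr) hr /le_trans/(_ rr) hr'.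
  by apply: le_trans (H3 _ _ hr hr') _; rewrite ler_wpM2r.
- move=> h /le_trans/(_ rr)/H4/le_trans; apply; rewrite ler_wpM2r//.
Qed.

Lemma analytic_close_on f g a N : analytic_at f a -> analytic_at g a ->
  (forall s, (size s <= N)%N -> iter_partial s f a = iter_partial s g a) ->
  exists r B, 0 < r /\ close_on f g a N r B.
Proof.
move=> /analytic_plimit[c [rho [S pf]]] /analytic_plimit[c' [rho' [S' pg]]] fg.
have r0 : 0 < Num.min rho rho' by case: pf => ? _ _; case: pg => ? _ _;
  rewrite lt_min; apply/andP.
have {}pf : plimit f a (Num.min rho rho') S (box c).
  by apply: plimit_shrink pf => //; rewrite ge_min lexx.
have {}pg : plimit g a (Num.min rho rho') S' (box c').
  by apply: plimit_shrink pg => //; rewrite ge_min lexx orbT.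
move: (Num.min _ _) r0 pf pg => {}rho r0 pf pg.
have cc al : (mdeg al < N)%N -> c al = c' al.
  move=> deg; apply: (mulIf (dweight_mseq al)).
  rewrite -(coefficient_partial al pf) -(coefficient_partial al pg).
  by apply: fg; rewrite size_mseq ltnW.
have S0 := plimit_ge0 pf; have S'0 := plimit_ge0 pg.
pose A := 2 / rho * S'; pose D := (S + S') / rho ^+ N.
have A0 : 0 <= A by rewrite mulr_ge0// divr_ge0// ltW.
have D0 : 0 <= D by rewrite divr_ge0 ?addr_ge0// exprn_ge0// ltW.
have r2 h : `|h : 'rV[R]_n| <= rho / 2 -> `|h| < rho.
  by move=> /le_lt_trans; apply; rewrite ltr_pdivrMr// ltr_pMr// ltr1n.
exists (rho / 2), (S + S' + A + D); split; first by rewrite divr_gt0.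
split.
- move=> h /r2/(plimit_bounded pf)/le_trans; apply; lra.
- move=> h /r2/(plimit_bounded pg)/le_trans; apply; lra.
- move=> h h' hr hr'; apply: le_trans (plimit_lipschitz pg hr hr') _.
  by rewrite ler_wpM2r// -/A; lra.
- move=> h /r2 hr; apply: le_trans (plimit_diff pf pg cc hr) _.
  by rewrite ler_wpM2r ?exprn_ge0// -/D; lra.
Qed.

Lemma finite_uniform_bounds (I : finType) (P : I -> R -> R -> Prop) :
  (forall i r B r' B', r' <= r -> B <= B' -> P i r B -> P i r' B') ->
  (forall i, exists r B, 0 < r /\ P i r B) ->
  exists r B, [/\ 0 < r, 0 < B & forall i, P i r B].
Proof.
move=> Pm HP.
have [F HF] := @choice _ _ (fun i (p : R * R) => 0 < p.1 /\ P i p.1 p.2)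
  (fun i => let: ex_intro r (ex_intro B H) := HP i in ex_intro _ (r, B) H).
exists (\big[Num.min/1]_i (F i).1), (1 + \sum_i `|(F i).2|); split.
- by elim/big_ind: _ => // [x y x0 y0|i _]; [rewrite lt_min x0|case: (HF i)].
- by rewrite ltr_wpDr// sumr_ge0.
- move=> i; have [_] := HF i; apply: Pm; first exact: bigmin_le_cond.
  rewrite (bigD1 i)//= addrCA (le_trans (ler_norm _))// lerDl.
  by rewrite addr_ge0// sumr_ge0.
Qed.

Lemma fields_close_on (m N : nat) (X Y : 'I_m.+1 -> 'rV[R]_n -> 'rV[R]_n) x0 :
  (forall i, analytic_vector_field (X i)) ->
  (forall i, analytic_vector_field (Y i)) ->
  (forall i, same_taylor N x0 (X i) (Y i)) ->
  exists r B, [/\ 0 < r, 0 < B &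
    [/\ forall i x, `|x - x0| <= r -> `|X i x| <= B,
        forall i x, `|x - x0| <= r -> `|Y i x| <= B,
        forall i x x', `|x - x0| <= r -> `|x' - x0| <= r ->
          `|Y i x - Y i x'| <= B * `|x - x'| &
        forall i x, `|x - x0| <= r -> `|X i x - Y i x| <= B * `|x - x0| ^+ N]].
Proof.
move=> aX aY XY.
pose P (ij : 'I_m.+1 * 'I_n) (r B : R) :=
  close_on (fun x => X ij.1 x ord0 ij.2) (fun x => Y ij.1 x ord0 ij.2) x0 N r B.
have [||r [B [r0 B0 H]]] := @finite_uniform_bounds _ P.
- by move=> ij r B r' B'; exact: close_onW.
- move=> [i j]; apply: analytic_close_on; [exact: aX|exact: aY|exact: XY].
have xE x : x = x0 + (x - x0) by rewrite subrKC.
exists r, B; split => //; split.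
- move=> i x xr; apply: row_norm_le => [|j]; first exact: ltW.
  by rewrite (xE x); have [+ _ _ _] := H (i, j); exact.
- move=> i x xr; apply: row_norm_le => [|j]; first exact: ltW.
  by rewrite (xE x); have [_ + _ _] := H (i, j); exact.
- move=> i x x' xr xr'; apply: row_norm_le => [|j].
    by rewrite mulr_ge0// ltW.
  have [_ _ /(_ _ _ xr xr') + _] := H (i, j); rewrite /= -!xE.
  have -> : x - x0 - (x' - x0) = x - x' by rewrite opprB addrA subrK.
  by rewrite !mxE.
- move=> i x xr; apply: row_norm_le => [|j].
    by rewrite mulr_ge0 ?exprn_ge0// ltW.
  by have [_ _ _ /(_ _ xr)] := H (i, j); rewrite /= -xE !mxE.
Qed.
End FieldEstimates.

(** * The correction scheme *)

Lemma indexed_dependent_choice (A : Type) (P : nat -> A -> Prop)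
    (Q : nat -> A -> A -> Prop) (a0 : A) : P 0%N a0 ->
  (forall k a, P k a -> exists b, P k.+1 b /\ Q k a b) ->
  exists F : nat -> A, forall k, P k (F k) /\ Q k (F k) (F k.+1).
Proof.
move=> P0 PQ.
(* Guarding by [P] makes the relation total, as [choice] requires; where [P] fails, [a] is a dummy
   value. *)
have [|g Hg] := @choice _ _
    (fun (ka : nat * A) b => P ka.1 ka.2 -> P ka.1.+1 b /\ Q ka.1 ka.2 b).
  move=> [k a] /=; have [/PQ[b H]|nP] := pselect (P k a); first by exists b.
  by exists a.
pose F := fix F k := if k is k'.+1 then g (k', F k') else a0.
have PF k : P k (F k) by elim: k => // k /(Hg (k, F k))[].
by exists F => k; split => //; exact: (Hg (k, F k) (PF k)).2.
Qed.

Section Clamp.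
Context {R : realType} {n : nat}.
Variables (x0 : 'rV[R]_n) (r : R).

(** Projection onto a sup-norm ball. Composing [Y] with it turns bounds near [x0] into the global
    ones that Picard iteration requires; on [[0, tau]] the solutions stay where it is the
    identity. *)
Definition clamp (x : 'rV[R]_n) : 'rV[R]_n :=
  \row_j (x0 ord0 j + Num.max (- r) (Num.min (x ord0 j - x0 ord0 j) r)).

Lemma clamp_dist x : 0 <= r -> `|clamp x - x0| <= r.
Proof.
move=> r0; apply: row_norm_le => // j; rewrite !mxE addrAC subrr add0r.
by rewrite ler_norml le_max lexx/= ge_max ge_min lexx orbT andbT ge0_cp.
Qed.

Lemma clamp_id x : `|x - x0| <= r -> clamp x = x.
Proof.
move=> xr; apply/rowP => j; rewrite mxE.
have := le_trans (row_norm_coord (x - x0) j) xr;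
  rewrite !mxE ler_norml => /andP[? ?].
by rewrite min_l// max_r// subrKC.
Qed.

Lemma clamp_lipschitz x x' : 0 <= r -> `|clamp x - clamp x'| <= `|x - x'|.
Proof.
move=> r0; apply: row_norm_le => // j; apply: le_trans (row_norm_coord _ j).
rewrite !mxE; move: (x ord0 j) (x' ord0 j) (x0 ord0 j) => a b c.
rewrite /Order.min /Order.max; case: (ltP (a - c) r) => ?;
  case: (ltP (b - c) r) => ?; case: (ltP (- r) (a - c)) => ?;
  case: (ltP (- r) (b - c)) => ?; case: (ltP (- r) r) => ?;
  rewrite ler_norml; apply/andP; split; case: (ger0P (a - b)) => ?; lra.
Qed.
End Clamp.

Section ControlledField.
Context {R : realType} {n m : nat}.

(** Stated for bare vectors so that it serves for values of the fields, for increments of [Y] and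
    for the difference of [X] and [Y]. *)
Lemma control_combination_le (Z : 'I_m.+1 -> 'rV[R]_n) (u : 'rV[R]_m) (b : R) :
  (forall i, `|u ord0 i| <= 1) -> (forall i, `|Z i| <= b) ->
  `|Z ord0 + \sum_(i < m) u ord0 i *: Z (lift ord0 i)| <= m.+1%:R * b.
Proof.
move=> u1 Zb; apply: le_trans (ler_normD _ _) _.
rewrite -natr1 addrC mulrDl mul1r lerD//.
apply: le_trans (ler_norm_sum _ _ _) _.
apply: le_trans (_ : \sum_(i < m) b <= _); last first.
  by rewrite sumr_const card_ord mulr_natl.
apply: ler_sum => i _; rewrite normrZ -[b]mul1r.
by apply: ler_pM.
Qed.

Lemma controlled_fieldB (X Y : 'I_m.+1 -> 'rV[R]_n -> 'rV[R]_n) u x x' :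
  controlled_field X u x - controlled_field Y u x' =
  (X ord0 x - Y ord0 x')
    + \sum_(i < m) u ord0 i *: (X (lift ord0 i) x - Y (lift ord0 i) x').
Proof.
rewrite /controlled_field opprD addrACA -sumrB; congr (_ + _).
by apply: eq_bigr => i _; rewrite scalerBr.
Qed.
End ControlledField.

Lemma lipschitz_measurable (R : realType) (g : R -> R) (D : R) : 0 <= D ->
  (forall s t, `|g s - g t| <= D * `|s - t|) -> measurable_fun setT g.
Proof.
move=> D0 gD; apply: continuous_measurable_fun => s.
apply/cvgrPdist_le => e e0; near=> t.
apply: le_trans (gD _ _) _.
apply: le_trans (_ : (D + 1) * (e / (D + 1)) <= _); last first.
  by rewrite mulrCA divff ?mulr1// gt_eqF// ltr_wpDl.
apply: ler_pM => //; first by rewrite lerDl.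
near: t; apply: (@cvgr_dist_le R R^o _ _ _ (fun t : R => t));
  first exact: cvg_id.
by rewrite divr_gt0// ltr_wpDl.
Unshelve. all: by end_near. Qed.

Section Correction.
Context {R : realType} {n m : nat}.
Notation mu := (@lebesgue_measure R).
Variables (X Y : 'I_m.+1 -> 'rV[R]_n -> 'rV[R]_n) (x0 y : 'rV[R]_n).
Variables (N : nat) (r B C tau : R).
Implicit Types (u : 'rV[R]_m) (x : 'rV[R]_n) (v : R -> 'rV[R]_m)
  (z : R -> 'rV[R]_n) (s t : R).
Let U : set 'rV[R]_m := [set u | forall i, -1 <= u ord0 i <= 1].
Let M := m.+1%:R * B.
Hypotheses (r0 : 0 < r) (B0 : 0 < B) (C0 : 0 < C).
Hypothesis bX : forall i x, `|x - x0| <= r -> `|X i x| <= B.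
Hypothesis bY : forall i x, `|x - x0| <= r -> `|Y i x| <= B.
Hypothesis lY : forall i x x', `|x - x0| <= r -> `|x' - x0| <= r ->
  `|Y i x - Y i x'| <= B * `|x - x'|.
Hypothesis dXY : forall i x, `|x - x0| <= r ->
  `|X i x - Y i x| <= B * `|x - x0| ^+ N.
Hypothesis eqY : Y ord0 x0 = 0.
Hypothesis N0 : (0 < N)%N.
Hypothesis reachX : forall (t : R) (z : 'rV[R]_n), 0 < t <= tau ->
  `|z - x0| <= C * t ^+ N -> reachable X U t x0 z.
(** [Mtau] makes the Picard iteration contract and absorbs the Lipschitz term in Gronwall. [Mtaur]
    and [Cr] each spend half of [r], on the motion and on the distance from [y] to [x0]. [tauC]
    makes the error [4 * M * (M * s) ^ N * s] of a window of length [s] fit in the next radius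
    [C * (s / 2) ^ N]. *)
Hypotheses (tau0 : 0 < tau) (tau1 : tau <= 1) (Mtau : M * tau <= 2^-1).
Hypotheses (Mtaur : M * tau <= r / 2) (Cr : C <= r / 2).
Hypothesis tauC : 4 * M * M ^+ N * tau <= C / 2 ^+ N.
Hypothesis yC : `|y - x0| <= C * (tau / 2) ^+ N.

Let admissible (v : R -> 'rV[R]_m) :=
  (forall i, measurable_fun setT (fun s => v s ord0 i)) /\
  (forall s i, `|v s ord0 i| <= 1).

Let Yt (u : 'rV[R]_m) (x : 'rV[R]_n) := controlled_field Y u (clamp x0 r x).

Let sol (v : R -> 'rV[R]_m) (z : R -> 'rV[R]_n) := [/\ z tau = y,
  forall s t, `|z s - z t| <= M * `|s - t| &
  {ae mu, forall s, 0 < s < tau -> deriv_at z s (Yt (v s) (z s))}].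

Let M0 : 0 < M. Proof. by rewrite mulr_gt0. Qed.

Let YtM u x : (forall i, `|u ord0 i| <= 1) -> `|Yt u x| <= M.
Proof.
move=> u1; rewrite /Yt /controlled_field.
apply: (@control_combination_le _ _ _ (fun i => Y i (clamp x0 r x))) => // i.
by apply: bY; apply: clamp_dist; exact: ltW.
Qed.

Let YtL u x x' : (forall i, `|u ord0 i| <= 1) ->
  `|Yt u x - Yt u x'| <= M * `|x - x'|.
Proof.
move=> u1; rewrite /Yt controlled_fieldB /M -mulrA.
apply: (@control_combination_le _ _ _
  (fun i => Y i (clamp x0 r x) - Y i (clamp x0 r x'))) => // i.
have r0' := ltW r0.
apply: le_trans (@lY i _ _ (clamp_dist _ _ r0') (clamp_dist _ _ r0')) _.
by rewrite ler_wpM2l ?(ltW B0)// clamp_lipschitz.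
Qed.

Let XM u x : (forall i, `|u ord0 i| <= 1) -> `|x - x0| <= r ->
  `|controlled_field X u x| <= M.
Proof.
move=> u1 xr; apply: (@control_combination_le _ _ _ (fun i => X i x)) => // i.
exact: bX.
Qed.

Let XYt u x : (forall i, `|u ord0 i| <= 1) -> `|x - x0| <= r ->
  `|controlled_field X u x - Yt u x| <= M * `|x - x0| ^+ N.
Proof.
move=> u1 xr; rewrite /Yt clamp_id// controlled_fieldB /M -mulrA.
by apply: (@control_combination_le _ _ _ (fun i => X i x - Y i x)) => // i;
  exact: dXY.
Qed.

Let UP u : (forall i, `|u ord0 i| <= 1) <-> U u.
Proof. by split=> H i; have := H i; rewrite ler_norml. Qed.

Let sol_exists v : admissible v -> exists z, sol v z.
Proof.
move=> [mv v1].
apply: (@picard_exists R n (fun s x => Yt (v s) x) M M tau y).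
- exact: ltW.
- exact: ltW.
- exact: ltW.
- exact: Mtau.
- by move=> s x; exact: YtM.
- by move=> s x x'; exact: YtL.
move=> z lz j; have r0' := ltW r0.
have mY i : measurable_fun setT (fun s => Y i (clamp x0 r (z s)) ord0 j).
  apply: (@lipschitz_measurable _ _ (B * M)) => [|s t].
    by rewrite mulr_ge0// ltW.
  have := row_norm_coord (Y i (clamp x0 r (z s)) - Y i (clamp x0 r (z t))) j.
  rewrite mxE [X in _ + X]mxE => /le_trans; apply.
  apply: le_trans (@lY i _ _ (clamp_dist _ _ r0') (clamp_dist _ _ r0')) _.
  rewrite -mulrA ler_wpM2l ?(ltW B0)//.
  exact: le_trans (clamp_lipschitz _ _ _ r0') (lz _ _).
rewrite [X in measurable_fun _ X](_ : _ = fun s => Y ord0 (clamp x0 r (z s))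
  ord0 j +
  \sum_(i < m) v s ord0 i * Y (lift ord0 i) (clamp x0 r (z s)) ord0 j);
    last first.
  apply/funext => s; rewrite /Yt /controlled_field mxE summxE; congr (_ + _).
  by apply: eq_bigr => i _; rewrite mxE.
apply: measurable_funD => //; apply: measurable_sum => i.
by apply: measurable_funM; [exact: mv|exact: mY].
Qed.

Let sol_dist v z : sol v z -> forall s, 0 <= s <= tau -> `|z s - y| <= r / 2.
Proof.
move=> [<- lz _] s /andP[s0 st]; apply: le_trans (lz _ _) _;
  apply: le_trans Mtaur.
rewrite ler_wpM2l ?(ltW M0)// distrC ger0_norm ?subr_ge0//.
by rewrite gerBl.
Qed.

Let sol_near v z : sol v z -> forall s, 0 <= s <= tau -> `|z s - x0| <= r.
Proof.
move=> sz s st; rewrite -(subrKA y) (le_trans (ler_normD _ _))//.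
rewrite (splitr r) lerD ?(sol_dist sz)//; apply: le_trans yC _.
apply: le_trans Cr; rewrite ler_piMr ?(ltW C0)// exprn_ile1//.
  by rewrite divr_ge0// ltW.
by rewrite ler_pdivrMr// mul1r (le_trans tau1)// ler1n.
Qed.

Let sol_ac v z a b : sol v z -> ac_on a b z.
Proof.
move=> [_ lz _]; apply: (@lipschitz_ac_on _ _ _ _ M) => s t _ st _.
by apply: le_trans (lz _ _) _; rewrite ger0_norm ?subr_ge0.
Qed.

(** Backward uniqueness: Gronwall with zero terminal error and [eta = 0]. *)
Let sol_agree v z v' z' s0 : 0 <= s0 <= tau -> admissible v' ->
  sol v z -> sol v' z' -> (forall s, s0 < s -> v s = v' s) ->
  forall s, s0 <= s <= tau -> z s = z' s.
Proof.
move=> /andP[s00 s0t] [_ v'1] sz sz' vv' s sst.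
have [zt lz dz] := sz; have [zt' lz' dz'] := sz'.
have : `|z s - z' s| <= 2 * `|z tau - z' tau| + 2 * (0 * (tau - s0)).
  apply: (@backward_gronwall _ _ s0 tau z z' M 0 r) => //.
  - exact: ltW.
  - apply: le_trans Mtau; rewrite ler_wpM2l ?(ltW M0)// gerBl//.
  - exact: sol_ac sz.
  - exact: sol_ac sz'.
  - move=> t /andP[st tt]; have tt' : 0 <= t <= tau by rewrite tt (le_trans
      s00).
    rewrite -(subrKA y) (le_trans (ler_normD _ _))// (splitr r) lerD//.
      exact: sol_dist sz _ tt'.
    by rewrite distrC; exact: sol_dist sz' _ tt'.
  - move: (ae_and dz dz'); apply: ae_imply => t [H H'] /andP[st tt].
    have t0 : 0 < t < tau by rewrite tt (le_lt_trans s00).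
    exists (Yt (v t) (z t)), (Yt (v' t) (z' t)); split; [exact: H|exact: H'|].
    by rewrite (vv' _ st) addr0; exact: YtL.
rewrite zt zt' subrr normr0 mul0r !mulr0 addr0 normr_le0 subr_eq0.
exact/eqP.
Qed.

(** The control that drives [X] is translated so as to end at [sg]; before its start, control 0
    fills the time that [X] did not use. *)
Let shifted_control (v u : R -> 'rV[R]_m) (sg T : R) (s : R) : 'rV[R]_m :=
  if sg < s then v s else if sg - T < s then u (s - (sg - T)) else 0.

Let shifted_control_admissible v (u : R -> 'rV[R]_m) (sg T : R) : admissible v
  ->
  (forall i, measurable_fun `[0, T] (fun t => u t ord0 i)) ->
  (forall t, 0 <= t <= T -> U (u t)) -> admissible (shifted_control v u sg T).
Proof.
move=> [mv v1] mu_ uU; split=> [i|s i]; last first.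
  rewrite /shifted_control; case: ltP => sgs; first exact: v1.
  case: ltP => cs; last by rewrite mxE normr0.
  by apply/UP: i; apply: uU; rewrite subr_ge0 (ltW cs) lerBlDr subrKC.
(* [u] is known to be measurable on [[0, T]] only; extended by 0 it can be composed with the
   translation. *)
pose ut := (fun t => u t ord0 i) \_ `[0, T].
have mut : measurable_fun setT ut by apply/(measurable_restrictT _ _).1.
rewrite [X in measurable_fun _ X](_ : _ = fun s => if sg < s then v s ord0 i
  else
   if sg - T < s then ut (s - (sg - T)) else 0); last first.
  apply/funext => s; rewrite /shifted_control; case: ltP => // sgs.
  case: ltP => cs; last by rewrite mxE.
  rewrite /ut patchE mem_set//= in_itv/=.
  by rewrite subr_ge0 (ltW cs) lerBlDr subrKC.
apply: measurable_fun_ifT.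
- exact: measurable_fun_ltr.
- exact: mv.
- apply: measurable_fun_ifT.
  + exact: measurable_fun_ltr.
  + apply: (measurableT_comp mut).
    by apply: measurable_funB => //; exact: measurable_cst.
  + exact: measurable_cst.
Qed.

(* The control reaching [z sg] for [X] is played on the window ending at [sg];
   run backward from [z sg], the trajectory of [Y] misses [x0] by an error of
   order [N + 1] in [sg], which is within the reach of a window half as long. *)
Let correction_step v z (sg : R) : 0 < sg <= tau -> admissible v -> sol v z ->
  `|z sg - x0| <= C * (sg / 2) ^+ N ->
  exists v' z', [/\ admissible v', sol v' z', forall s, sg < s -> v' s = v s,
    forall s, s <= sg / 2 -> v' s = 0 &
    `|z' (sg / 2) - x0| <= C * (sg / 2 / 2) ^+ N].
Proof.
move=> /andP[sg0 sgt] adv sz zsg.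
have sg2 : 0 < sg / 2 <= tau.
  rewrite divr_gt0//= (le_trans _ sgt)// ler_pdivrMr// ler_peMr ?(ltW sg0)//
    ler1n//.
have [T [x [/andP[T0 Tsg] [u [mu_ uU [acx dx]]] x00 xT]]] := reachX sg2 zsg.
(* The translated trajectory leaves [x0] at time [c], which is at least [sg / 2] because
   [T <= sg / 2]. *)
set c := sg - T.
pose v' := shifted_control v u sg T.
have adv' : admissible v' by exact: shifted_control_admissible.
have [z' sz'] := sol_exists adv'; have [_ lz' dz'] := sz'.
have M0' := ltW M0.
have sg2c : sg / 2 <= c by rewrite /c; lra.
have csg : c <= sg by rewrite gerBl.
have sgc : sg - c = T by rewrite /c subKr.
exists v', z'; split => //.
- by move=> s ss; rewrite /v' /shifted_control ss.
- move=> s ss; rewrite /v' /shifted_control !ltNge (le_trans ss)//=.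
    by rewrite (le_trans ss).
  exact: le_trans csg.
have z'sg : z' sg = z sg.
  apply: (@sol_agree v' z' v z sg) => //; rewrite ?lexx ?sgt ?(ltW sg0)//.
  by move=> s ss; rewrite /v' /shifted_control ss.
have acx' : ac_on 0 T x.
  move=> e /acx[d d0 H]; exists d => // k l l' lr dis sd.
  apply: le_lt_trans (H k l l' lr dis sd).
  by apply: ler_sum => i _; exact: le_norm_euclidean.
have MT : M * T < r.
  apply: le_lt_trans (_ : M * tau < r).
    by rewrite ler_wpM2l// (le_trans Tsg)//; case/andP: sg2.
  by apply: le_lt_trans Mtaur _; rewrite ltr_pdivrMr// ltr_pMr// ltr1n.
(* The bounds on [X] hold only near [x0], hence the bootstrap. *)
have x_near t : 0 <= t <= T -> `|x t - x0| <= M * t.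
  rewrite -[X in M * X]subr0 -x00; apply: (@ac_on_confined _ _ 0 T x M r) => //.
    by rewrite subr0.
  move: dx; apply: ae_imply => s H /andP[s0 sT]; rewrite x00 => xr.
  have sT' : 0 <= s <= T by rewrite !ltW.
  exists (controlled_field X (u s) (x s)); first exact: is_derive_deriv_at (H
    sT').
  by apply: XM => //; apply/UP; exact: uU.
have x_r t : 0 <= t <= T -> `|x t - x0| <= r.
  move=> tT; apply: le_trans (x_near _ tT) (ltW _); apply: le_lt_trans MT.
  by rewrite ler_wpM2l//; case/andP: tT.
pose p s := x (s - c).
(* Bound for the difference of the fields along [p], which stays within [M * (sg / 2)] of [x0]. *)
pose eta := M * (M * (sg / 2)) ^+ N.
have eta0 : 0 <= eta.
  by apply: mulr_ge0 => //; apply: exprn_ge0; apply: mulr_ge0 => //;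
    rewrite divr_ge0// ltW.
have z'_r s : 0 <= s <= tau -> `|z' s - x0| <= r by exact: (sol_near sz').
have wT s : c <= s <= sg -> 0 <= s - c <= T.
  by move=> /andP[cs ss]; rewrite subr_ge0 cs /= -sgc lerD2r.
have win s : c <= s <= sg -> 0 <= s <= tau.
  move=> /andP[cs ss]; rewrite (le_trans ss)// andbT (le_trans _ cs)//.
  by rewrite (le_trans _ sg2c)// divr_ge0// ltW.
(* The curves meet at [sg], so only the [eta] term of Gronwall remains. *)
have first_half : `|p c - z' c| <= 2 * (eta * T).
  have := @backward_gronwall _ _ c sg p z' M eta (r + r) csg M0' eta0.
  rewrite sgc /p sgc z'sg xT subrr normr0 mulr0 add0r; apply.
  - apply: le_trans Mtau; rewrite ler_wpM2l// (le_trans Tsg)//.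
    by case/andP: sg2.
  - by have := ac_on_shift c acx'; rewrite add0r -sgc subrK.
  - exact: sol_ac sz'.
  - move=> t tw; rewrite -(subrKA x0) (le_trans (ler_normD _ _))// lerD//.
      by apply: x_r; exact: wT.
    by rewrite distrC; apply: z'_r; exact: win.
  - move: (ae_and (ae_shift c dx) dz'); apply: ae_imply => s [H H'] /andP[cs
      ss].
    have sw : c <= s <= sg by rewrite !ltW.
    have v'E : v' s = u (s - c) by rewrite /v' /shifted_control ltNge (ltW
      ss)/= cs.
    exists (controlled_field X (v' s) (p s)), (Yt (v' s) (z' s)); split.
    + by rewrite v'E; apply: deriv_at_shift; apply: is_derive_deriv_at;
        apply: H; exact: wT.
    + apply: H'; rewrite (lt_le_trans ss)// andbT (le_lt_trans _ cs)//.
      by rewrite (le_trans _ sg2c)// divr_ge0// ltW.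
    + have v'1 i : `|v' s ord0 i| <= 1 by exact: adv'.2.
      (* Through [Yt] at [p s]: the Lipschitz bound covers the change of point, the Taylor bound the
         change of field. *)
      rewrite -(subrKA (Yt (v' s) (p s))) addrC.
      rewrite (le_trans (ler_normD _ _))// lerD//; first exact: YtL.
      apply: le_trans (XYt v'1 (x_r _ (wT _ sw))) _; rewrite /eta ler_wpM2l//.
      rewrite lerXn2r ?nnegrE ?mulr_ge0// ?divr_ge0 ?(ltW sg0) ?(ltW B0)//.
      apply: le_trans (x_near _ (wT _ sw)) _; rewrite ler_wpM2l//.
      by apply: le_trans Tsg; case/andP: (wT _ sw).
  - by rewrite lexx csg.
have pc : p c = x0 by rewrite /p subrr.
(* On [[sg / 2, c]] the control is 0, so the constant curve [x0] solves the same equation and [eta]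
   is 0. *)
have second_half : `|x0 - z' (sg / 2)| <= 2 * `|x0 - z' c|.
  have := @backward_gronwall _ _ (sg / 2) c (fun=> x0) z' M 0 r sg2c M0' (lexx
    _).
  rewrite mul0r mulr0 addr0; apply.
  - apply: le_trans Mtau; rewrite ler_wpM2l// (le_trans _ sgt)//.
    by rewrite lerBlDr (le_trans csg)// lerDl divr_ge0// ltW.
  - by apply: (@lipschitz_ac_on _ _ _ _ 0) => *; rewrite subrr normr0 mul0r.
  - exact: sol_ac sz'.
  - move=> t /andP[st tc]; rewrite distrC; apply: z'_r.
    rewrite (le_trans tc (le_trans csg sgt)) (le_trans _ st)//.
    by rewrite divr_ge0// ltW.
  - move: dz'; apply: ae_imply => s H /andP[ss sc].
    have v'0 : v' s = 0.
      by rewrite /v' /shifted_control !ltNge (ltW sc) (le_trans (ltW sc) csg).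
    exists 0, (Yt (v' s) (z' s)); split.
    + exact: deriv_at_cst.
    + apply: H; rewrite (lt_le_trans sc (le_trans csg sgt)) andbT.
      by rewrite (le_lt_trans _ ss)// divr_ge0// ltW.
    + have -> : 0 = Yt (v' s) x0.
        rewrite v'0 /Yt clamp_id ?subrr ?normr0 ?(ltW r0)// /controlled_field
          eqY.
        by rewrite big1 ?addr0// => i _; rewrite mxE scale0r.
      by rewrite addr0; apply: YtL => i; exact: adv'.2.
  - by rewrite lexx sg2c.
rewrite distrC; apply: le_trans second_half _.
rewrite -{1}pc; apply: le_trans (ler_wpM2l _ first_half) _ => //.
apply: le_trans (_ : 2 * (2 * (eta * (sg / 2))) <= _).
  by rewrite !ler_wpM2l.
have -> : C * (sg / 2 / 2) ^+ N = C / 2 ^+ N * (sg / 2) ^+ N.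
  by rewrite expr_div_n mulrA mulrAC.
have h1 : 4 * M * M ^+ N * (sg / 2) <= C / 2 ^+ N.
  apply: le_trans tauC; rewrite ler_wpM2l//; last by case/andP: sg2.
  by apply: mulr_ge0; [apply: mulr_ge0|apply: exprn_ge0].
have h2 : 0 <= (sg / 2) ^+ N by rewrite exprn_ge0// divr_ge0// ltW.
apply: le_trans (ler_wpM2r h2 h1); rewrite /eta exprMn.
by rewrite le_eqVlt; apply/orP; left; apply/eqP; ring.
Qed.

Lemma corrected_reachable : reachable Y U tau x0 y.
Proof.
pose sg k := tau / 2 ^+ k.
have sg0 k : 0 < sg k by rewrite divr_gt0// exprn_gt0.
have sgS k : sg k.+1 = sg k / 2 by rewrite /sg exprSr invfM mulrA.
have sgt k : sg k <= tau by rewrite ler_pdivrMr ?exprn_gt0// ler_peMr ?(ltW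
  tau0)// exprn_ege1// ler1n.
have sg_cvg : sg @ \oo --> (0 : R).
  have : (fun k => tau * (2^-1) ^+ k) @ \oo --> (0 : R).
    by apply: cvg_geometric; rewrite ger0_norm ?invr_ge0// invf_lt1// ltr1n.
  by apply: cvg_trans; apply: near_eq_cvg; near=> k; rewrite /sg exprVn.
pose P k (vz : (R -> 'rV[R]_m) * (R -> 'rV[R]_n)) :=
  [/\ admissible vz.1, sol vz.1 vz.2, forall s, s <= sg k -> vz.1 s = 0 &
      `|vz.2 (sg k) - x0| <= C * (sg k / 2) ^+ N].
pose Q k (a b : (R -> 'rV[R]_m) * (R -> 'rV[R]_n)) :=
  forall s, sg k < s -> b.1 s = a.1 s.
have ad0 : admissible (fun=> 0).
  split=> [i|s i]; last by rewrite mxE normr0.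
  exact: measurable_cst.
have [z0 sz0] := sol_exists ad0.
have [||F HF] := @indexed_dependent_choice _ P Q ((fun=> 0), z0).
- split => //=; rewrite /sg expr0 divr1.
  by case: sz0 => ->.
- move=> k [v z] [/= adv sz v0 zk].
  have [|v' [z' [adv' sz' v'v v'0 z'k]]] := correction_step _ adv sz zk.
    by rewrite sg0 sgt.
  exists (v', z'); split; last exact: v'v.
  by split; rewrite /= ?sgS.
have vk_const s k j : sg k < s -> (F (j + k)%N).1 s = (F k).1 s.
  move=> ks; elim: j => // j <-; rewrite addSn; apply: (HF (j + k)%N).2.
  apply: le_lt_trans ks; elim: j => // j; apply: le_trans.
  by rewrite addSn sgS ler_pdivrMr// ler_peMr ?(ltW (sg0 _))// ler1n.
(* At [s > 0] the stage controls stop changing once [sg k < s]; at [s <= 0] they are all 0 by the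
   third clause of [P]. *)
have [|w Hw] := @choice _ _ (fun s (w : 'rV[R]_m) =>
    exists K, forall k, (K <= k)%N -> (F k).1 s = w).
  move=> s; have [s0|s0] := leP s 0.
    exists 0, 0%N => k _; have [[_ _ + _] _] := HF k; apply.
    exact: le_trans s0 (ltW (sg0 k)).
  have [k ks] : exists k, sg k < s.
    have /cvgrPdist_lt/(_ s s0)[k _ /(_ k (leqnn k))] := sg_cvg.
    by rewrite /= sub0r normrN gtr0_norm// => ?; exists k.
  by exists ((F k).1 s), k => j kj; rewrite -(subnK kj) vk_const.
have wv s k : sg k < s -> w s = (F k).1 s.
  move=> ks; have [K HK] := Hw s.
  by rewrite -(HK (K + k)%N) ?leq_addr// vk_const.
have adw : admissible w.
  split=> [i|s i].
    apply: (@measurable_fun_cvg _ _ _ _ (fun k s => (F k).1 s ord0 i)).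
      by move=> k; have [[[+ _] _ _ _] _] := HF k; exact.
    move=> s _; apply: cvg_near_cst; have [K HK] := Hw s.
    by exists K => // k /= /HK ->.
  have [K HK] := Hw s; rewrite -(HK K)//.
  by have [[[_ +] _ _ _] _] := HF K; exact.
have [z sz] := sol_exists adw; have [zt lz dz] := sz.
(* Since [N] is positive and [sg k <= 1], a linear bound follows, which is enough for the limit at
   time 0. *)
have zk k : `|z (sg k) - x0| <= C * sg k.
  have [[adk szk _ zk] _] := HF k.
  rewrite (@sol_agree w z (F k).1 (F k).2 (sg k))//; last 3 first.
  - by rewrite (ltW (sg0 k)) sgt.
  - by move=> s; exact: wv.
  - by rewrite lexx sgt.
  apply: le_trans zk _; rewrite ler_wpM2l ?(ltW C0)//.
  have sk2 : 0 <= sg k / 2 by rewrite divr_ge0// ltW.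
  have sk1 : sg k <= 1 by exact: le_trans tau1.
  case: (N) N0 => // N' _; rewrite exprS.
  apply: le_trans (_ : sg k / 2 * 1 <= _).
    by rewrite ler_wpM2l// exprn_ile1//; lra.
  by have := ltW (sg0 k); lra.
have z0E : z 0 = x0.
  apply/eqP; rewrite -subr_eq0 -normr_le0; apply/ler_addgt0Pr => e e0.
  (* [M] pays for the motion between times 0 and [sg k], [C] for the remaining distance to [x0]. *)
  have MC : 0 < M + C + 1 by rewrite !addr_gt0.
  have /cvgrPdist_lt/(_ (e / (M + C + 1)))[|k _ /(_ k (leqnn k))] := sg_cvg.
    by rewrite divr_gt0.
  rewrite /= sub0r normrN gtr0_norm// ltr_pdivlMr// => /ltW ke.
  rewrite add0r; apply: le_trans ke.
  rewrite -(subrKA (z (sg k))) (le_trans (ler_normD _ _))//.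
  have := lz 0 (sg k); rewrite sub0r normrN gtr0_norm// => h1.
  apply: le_trans (lerD h1 (zk k)) _; rewrite -mulrDl mulrC ler_wpM2l//.
    exact: ltW.
  by rewrite lerDl.
exists tau, z; split => //; first by rewrite lexx (ltW tau0).
exists w; split.
- by move=> i; apply: measurable_funTS; exact: adw.1.
- by move=> t _; apply/UP; exact: adw.2.
split.
- have D0 : 0 <= n.+1%:R * M by rewrite mulr_ge0// ltW.
  move=> e e0; exists (e / (n.+1%:R * M + 1));
    first by rewrite divr_gt0// ltr_wpDl.
  move=> k a b ab _ H.
  apply: le_lt_trans (_ : (n.+1%:R * M + 1) * \sum_i (b i - a i) < e);
    last first.
    by rewrite mulrC -ltr_pdivlMr// ltr_wpDl.
  rewrite mulr_sumr; apply: ler_sum => i _; have [_ abi _] := ab i.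
  apply: le_trans (euclidean_le_norm _) _.
  apply: le_trans (_ : n.+1%:R * M * (b i - a i) <= _); last first.
    by rewrite ler_wpM2r ?subr_ge0// lerDl.
  rewrite -mulrA ler_wpM2l//; apply: le_trans (lz _ _) _.
  by rewrite ger0_norm ?subr_ge0.
(* [dz] speaks of the open interval; the two end points are discarded as null sets. *)
- have ne c : {ae mu, forall t, t <> c}.
    exists [set c]; split; [exact: measurable_set1|exact:
      lebesgue_measure_set1|].
    by move=> t /= /contrapT.
  move: (ae_and dz (ae_and (ne 0) (ne tau))); apply: ae_imply.
  move=> t [H [t0 tt]] /andP[t0' tt'].
  have := H _; rewrite /Yt clamp_id; last first.
    by apply: (sol_near sz); rewrite t0'.
  move=> {}H; apply: deriv_at_is_derive; apply: H.
  by rewrite !lt_neqAle t0' tt' !andbT eq_sym; apply/andP; split; apply/eqP.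
Unshelve. all: by end_near. Qed.
End Correction.

Theorem theorem7p1 (R : realType) (n m N : nat)
    (X Y : 'I_m.+1 -> 'rV[R]_n -> 'rV[R]_n) (U : set 'rV[R]_m)
    (x0 : 'rV[R]_n)
    (hX : analytic_control_affine_system X U)
    (hY : analytic_control_affine_system Y U)
    (aX : standing_assumption X U)
    (aY : standing_assumption Y U)
    (hN : (1 <= N)%N)
    (eqX : equilibrium X x0)
    (eqY : equilibrium Y x0)
    (growthX : growth_rate_condition X U N x0)
    (taylorXY : forall i : 'I_m.+1, same_taylor N x0 (X i) (Y i)) :
  growth_rate_condition Y U N x0.
Proof.
have [r [B [r0 B0 [bX bY lY dXY]]]] := fields_close_on hX.1 hY.1 taylorXY.
case: aX => _ UE; case: growthX => C [T [C0 T0 reachX]].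
rewrite UE in reachX *.
pose M : R := m.+1%:R * B; have M0 : 0 < M by rewrite mulr_gt0.
(* Dividing by [n.+1] turns the Euclidean ball reached by [X] into a sup-norm one; [r / 2] secures
   [Cr]. *)
pose C1 := Num.min (C / n.+1%:R) (r / 2).
have C10 : 0 < C1 by rewrite lt_min !divr_gt0.
pose D := 4 * M * M ^+ N.
have D0 : 0 < D by rewrite mulr_gt0 ?exprn_gt0// mulr_gt0.
(* [E * t ^+ N] is [C1 * (t / 2) ^+ N], the radius required by [yC]. *)
pose E := C1 / 2 ^+ N; have E0 : 0 < E by rewrite divr_gt0// exprn_gt0.
(* In order, the entries give [tau1], [reachX], [Mtau], [Mtaur] and [tauC]. *)
exists E, (Num.min (Num.min 1 T) (Num.min (Num.min (2^-1 / M) (r / 2 / M)) (E /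
  D))).
split => //; first by rewrite !lt_min ltr01 T0 !divr_gt0.
move=> t; rewrite !le_min => /andP[t0 /andP[/andP[t1 tT] /andP[/andP[tM tr]
  tD]]].
move=> y /= yE.
apply: (@corrected_reachable R n m X Y x0 y N r B C1 t) => //.
- move=> s z /andP[s0 st] zC; apply: reachX; first by rewrite s0 (le_trans st).
  apply: le_trans (euclidean_le_norm _) _.
  rewrite mulrC -ler_pdivlMr// mulrAC; apply: le_trans zC _.
  by rewrite ler_wpM2r ?exprn_ge0 ?(ltW s0)// ge_min lexx.
- by rewrite mulrC -ler_pdivlMr.
- by rewrite mulrC -ler_pdivlMr.
- by rewrite ge_min lexx orbT.
- by rewrite -/M mulrC -ler_pdivlMr.
- apply: le_trans (le_norm_euclidean _) _; apply: le_trans yE _.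
  by rewrite expr_div_n mulrA mulrAC.
Qed.
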